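(* Let $\Delta$ be an irreducible reduced root system and $S\subset\Pi_l$; let $\langle S\rangle$ be the smallest subset of $\Pi_l$ containing $S$ that is connected in the Dynkin diagram. Then (i) $\bigcap_{\alpha\in S}I(\alpha)_{\sf min}=\bigcap_{\alpha\in\langle S\rangle}I(\alpha)_{\sf min}$; (ii) if $\Delta$ is not of type $A_n$, then $\bigcup_{\alpha\in S}I(\alpha)_{\sf max}=\bigcup_{\alpha\in\langle S\rangle}I(\alpha)_{\sf max}$.
   Context: $\Delta^+$, $\Pi$, $\theta$: positive roots, simple roots, highest root; $W$ the Weyl group, $(\ ,\ )$ a $W$-invariant inner product. $\Delta^+_l$ is the set of long positive roots and $\Pi_l=\Pi\cap\Delta^+_l$. $\mathcal H=\{\gamma\in\Delta^+\mid(\gamma,\theta)>0\}$. An upper ideal of $\Delta^+$ is $I\subset\Delta^+$ with $\gamma\in I,\nu\in\Delta^+,\nu+\gamma\in\Delta^+\Rightarrow\nu+\gamma\in I$; it is abelian if $\gamma'+\gamma''\notin\Delta^+$ for all $\gamma',\gamma''\in I$. For $w\in W$, $N(w)=\{\gamma\in\Delta^+\mid w(\gamma)\in-\Delta^+\}$. For $\mu\in\Delta^+_l$, let $w_\mu$ be the unique minimal-length element of $W$ with $w_\mu(\theta)=\mu$ and $I(\mu)_{\sf min}=\{\theta\}\cup\{\theta-\gamma\mid\gamma\in N(w_\mu)\}$ (an abelian upper ideal contained in $\mathcal H$). It is known that among nonempty abelian upper ideals $I$ with $I\cap\mathcal H=I(\mu)_{\sf min}$ there is a unique maximal one, denoted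 $I(\mu)_{\sf max}$. *)

(* Defs.v *)
(* Root systems are modelled as finite sets (uniq seqs) of
   row vectors in 'rV[R]_n, R a real field, with the standard dot product
   as the W-invariant inner product. *)
From HB Require Import structures.
From mathcomp Require Import all_boot all_order all_algebra.
Set Implicit Arguments.
Unset Strict Implicit.
Unset Printing Implicit Defensive.
Import Order.TTheory GRing.Theory Num.Theory.
Local Open Scope ring_scope.

Section RootSystems.
Variables (R : realFieldType) (n : nat).
Local Notation V := 'rV[R]_n.

Definition dotp (u v : V) : R := \sum_(i < n) u 0 i * v 0 i.

Definition refl (a v : V) : V := v - (2 * dotp v a / dotp a a) *: a.

Definition cartan (b a : V) : R := 2 * dotp b a / dotp a a.

Definition root_system (D : seq V) : Prop :=
  [/\ uniq D, (0 : V) \notin D, (span D = fullv)%VS &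
      (forall a b, a \in D -> b \in D -> refl a b \in D)] /\
  (forall a b, a \in D -> b \in D -> exists z : int, cartan b a = z%:~R) /\
  (forall a (c : R), a \in D -> c *: a \in D -> c = 1 \/ c = -1).

Definition irreducible (D : seq V) : Prop :=
  forall P : V -> Prop,
    (forall a b, a \in D -> b \in D -> P a -> ~ P b -> dotp a b = 0) ->
    (forall a, a \in D -> P a) \/ (forall a, a \in D -> ~ P a).

Definition nncomb (Pi : seq V) (v : V) : Prop :=
  exists c : V -> nat, v = \sum_(a <- Pi) (c a)%:R *: a.

Definition is_base (D Pi : seq V) : Prop :=
  [/\ uniq Pi, {subset Pi <= D}, free Pi &
      forall b, b \in D -> nncomb Pi b \/ nncomb Pi (- b)].

Definition posroot (D Pi : seq V) (g : V) : Prop := g \in D /\ nncomb Pi g.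

Definition highest_root (D Pi : seq V) (th : V) : Prop :=
  th \in D /\ forall g, g \in D -> nncomb Pi (th - g).

Definition long (D : seq V) (g : V) : Prop :=
  g \in D /\ forall b, b \in D -> dotp b b <= dotp g g.

(* action of the Weyl group element s_{a1} ... s_{ak} given by a word *)
Definition wact (ws : seq V) (v : V) : V := foldr refl v ws.

Definition word (Pi : seq V) (ws : seq V) : Prop := {subset ws <= Pi}.

(* ws is a reduced word for the minimal-length element w with w(theta)=mu *)
Definition minword (Pi : seq V) (th mu : V) (ws : seq V) : Prop :=
  [/\ word Pi ws, wact ws th = mu &
      forall ws', word Pi ws' -> wact ws' th = mu -> (size ws <= size ws')%N].

Definition Ninv (D Pi ws : seq V) (g : V) : Prop :=
  posroot D Pi g /\ posroot D Pi (- wact ws g).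

Definition Imin (D Pi : seq V) (th mu : V) (x : V) : Prop :=
  exists ws, minword Pi th mu ws /\
    (x = th \/ exists g, Ninv D Pi ws g /\ x = th - g).

Definition Hset (D Pi : seq V) (th : V) (g : V) : Prop :=
  posroot D Pi g /\ 0 < dotp g th.

Definition upper_ideal (D Pi : seq V) (I : V -> Prop) : Prop :=
  (forall g, I g -> posroot D Pi g) /\
  (forall g nu, I g -> posroot D Pi nu -> posroot D Pi (nu + g) -> I (nu + g)).

Definition abelian_ideal (D Pi : seq V) (I : V -> Prop) : Prop :=
  upper_ideal D Pi I /\
  forall g1 g2, I g1 -> I g2 -> ~ posroot D Pi (g1 + g2).

Definition Imin_ideal (D Pi : seq V) (th mu : V) (I : V -> Prop) : Prop :=
  [/\ abelian_ideal D Pi I, (exists g, I g) &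
      forall x, (I x /\ Hset D Pi th x) <-> Imin D Pi th mu x].

Definition is_Imax (D Pi : seq V) (th mu : V) (I : V -> Prop) : Prop :=
  Imin_ideal D Pi th mu I /\
  forall J, Imin_ideal D Pi th mu J -> forall x, J x -> I x.

Definition Imax (D Pi : seq V) (th mu : V) (x : V) : Prop :=
  exists I, is_Imax D Pi th mu I /\ I x.

Definition dynkin_adj (a b : V) : bool := (a != b) && (dotp a b != 0).

Definition dconnected (T : V -> Prop) : Prop :=
  forall a b, T a -> T b ->
    exists p : seq V, (forall x, x \in p -> T x) /\
                      path dynkin_adj a p /\ last a p = b.

Definition conn_hull (D Pi : seq V) (S T : V -> Prop) : Prop :=
  [/\ (forall a, T a -> a \in Pi /\ long D a),
      (forall a, S a -> T a),
      dconnected T &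
      (forall T', (forall a, T' a -> a \in Pi /\ long D a) ->
                  (forall a, S a -> T' a) -> dconnected T' ->
                  forall a, T a -> T' a)].

Definition typeA (Pi : seq V) : Prop :=
  exists s : seq V, perm_eq s Pi /\
    forall i j, (i < size s)%N -> (j < size s)%N ->
      cartan (nth 0 s i) (nth 0 s j) =
        (if i == j then 2 else if (i == j.+1) || (j == i.+1) then -1 else 0).

End RootSystems.

(* Main.v *)
(* For a long simple root a, the shortest w with w th = a turns Delta^+ into the
   positive system formed by the roots b with (b, a) > 0 and the positive roots
   orthogonal to a. Hence x in H lies in I(a)_min iff w x > 0, and I(a)_max
   consists of I(a)_min and of the x orthogonal to th whose image g = w x is
   orthogonal to a and commutes with every positive root b with (b, a) > 0.
   Climbing from such a g to th by simple roots only uses simple roots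
   orthogonal to a, so g and th have the same coefficient at a; this makes the
   set abelian.
   For adjacent long simple roots a, b one has w_b = s_a s_b w_a, so membership
   can be followed along paths of the Dynkin diagram. In (i), a root that leaves
   I(.)_min along a path never comes back. In (ii), the case x in H follows from
   (i) applied to th - x, as x and th - x are never both in I(a)_min. If x is
   orthogonal to th, then w_a x is orthogonal to all simple roots outside the
   component of the diagram minus a that contains the nodes attached to th;
   outside type A there is just one such node, hence one such component, and x
   stays in I(.)_max along every path leaving a in another direction. *)
Require Import Defs.
From mathcomp Require Import all_boot all_order all_algebra.
From mathcomp Require Import zify ring lra.
From Stdlib Require Import Classical_Prop.
Set Implicit Arguments.
Unset Strict Implicit.
Unset Printing Implicit Defensive.
Import Order.TTheory GRing.Theory Num.Theory.
Local Open Scope ring_scope.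

(** * Dot product, reflections, actions of words, natural combinations *)

Section Euclidean.
Context {R : realFieldType} {n : nat}.
Implicit Types (u v a b : 'rV[R]_n) (ws : seq 'rV[R]_n).

Lemma dotpC u v : dotp u v = dotp v u.
Proof. by apply: eq_bigr => i _; rewrite mulrC. Qed.

Lemma dotpDl u1 u2 v : dotp (u1 + u2) v = dotp u1 v + dotp u2 v.
Proof. by rewrite -big_split; apply: eq_bigr => i _; rewrite mxE mulrDl. Qed.

Lemma dotpZl k u v : dotp (k *: u) v = k * dotp u v.
Proof. by rewrite /dotp big_distrr; apply: eq_bigr => i _; rewrite mxE -mulrA. Qed.

Lemma dotpDr u v1 v2 : dotp u (v1 + v2) = dotp u v1 + dotp u v2.
Proof. by rewrite !(dotpC u) dotpDl. Qed.

Lemma dotpZr k u v : dotp u (k *: v) = k * dotp u v.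
Proof. by rewrite !(dotpC u) dotpZl. Qed.

Lemma dotpNl u v : dotp (- u) v = - dotp u v.
Proof. by rewrite -scaleN1r dotpZl mulN1r. Qed.

Lemma dotpNr u v : dotp u (- v) = - dotp u v.
Proof. by rewrite !(dotpC u) dotpNl. Qed.

Lemma dotp0r u : dotp u 0 = 0.
Proof. by rewrite -(scale0r 0) dotpZr mul0r. Qed.

Definition dotpE := (dotpDl, dotpDr, dotpNl, dotpNr, dotpZl, dotpZr).

Lemma dotp_ge0 v : 0 <= dotp v v.
Proof. by apply: sumr_ge0 => i _; rewrite -expr2 sqr_ge0. Qed.

Lemma dotp_eq0 v : dotp v v <= 0 -> v = 0.
Proof.
move=> h; have /eqP : dotp v v = 0 by apply/eqP; rewrite eq_le h dotp_ge0.
rewrite psumr_eq0 => [|i _]; last by rewrite -expr2 sqr_ge0.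
move=> /allP h0; apply/rowP => i; rewrite mxE.
by move: (h0 i (mem_index_enum i)); rewrite /= mulf_eq0 orbb => /eqP.
Qed.

Lemma dotp_gt0 v : v != 0 -> 0 < dotp v v.
Proof.
move=> hv; rewrite lt_neqAle dotp_ge0 andbT; apply/eqP => h.
by case/eqP: hv; apply: dotp_eq0; rewrite -h.
Qed.

Lemma dotp_sumr (r : seq 'rV[R]_n) F u :
  dotp u (\sum_(a <- r) F a) = \sum_(a <- r) dotp u (F a).
Proof.
elim: r => [|a r IH]; first by rewrite !big_nil dotp0r.
by rewrite !big_cons dotpDr IH.
Qed.

Lemma reflD a u v : refl a (u + v) = refl a u + refl a v.
Proof. by rewrite /refl dotpDl mulrDr mulrDl scalerDl opprD addrACA. Qed.

Lemma reflZ a k v : refl a (k *: v) = k *: refl a v.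
Proof. by rewrite /refl dotpZl scalerBr scalerA; congr (_ - _ *: _); ring. Qed.

Lemma refl_dotp a u v : a != 0 -> dotp (refl a u) (refl a v) = dotp u v.
Proof.
move=> /dotp_gt0 h; rewrite /refl !dotpE (dotpC a v).
have hz : dotp a a != 0 by rewrite gt_eqF.
set x := dotp u a; set y := dotp v a; set c := dotp a a in hz *.
have hp : 2 * x / c * c = 2 * x by rewrite divfK.
have hq : 2 * y / c * c = 2 * y by rewrite divfK.
move: hp hq; set p := 2 * x / c; set q := 2 * y / c => hp hq.
have e1 : p * (q * c) = p * (2 * y) by rewrite hq.
have e2 : q * (p * c) = q * (2 * x) by rewrite hp.
by lra.
Qed.

Lemma refl_self a : a != 0 -> refl a a = - a.
Proof.
move=> /dotp_gt0 h; rewrite /refl mulfK ?gt_eqF //.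
by rewrite scaler_nat mulr2n opprD addrA subrr add0r.
Qed.

Lemma refl_orth a v : dotp v a = 0 -> refl a v = v.
Proof. by move=> h; rewrite /refl h mulr0 mul0r scale0r subr0. Qed.

Lemma reflK a v : a != 0 -> refl a (refl a v) = v.
Proof.
move=> ha; rewrite {2}/refl reflD -scaleNr reflZ refl_self // /refl.
by rewrite scaleNr scalerN opprK addrNK.
Qed.

Lemma wact_cons a ws v : wact (a :: ws) v = refl a (wact ws v).
Proof. by []. Qed.

Lemma wactD ws u v : wact ws (u + v) = wact ws u + wact ws v.
Proof. by elim: ws => //= a ws ->; rewrite reflD. Qed.

Lemma wactZ ws k v : wact ws (k *: v) = k *: wact ws v.
Proof. by elim: ws => //= a ws ->; rewrite reflZ. Qed.

Lemma wactN ws v : wact ws (- v) = - wact ws v.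
Proof. by rewrite -scaleN1r wactZ scaleN1r. Qed.

Lemma wact_cat ws1 ws2 v : wact (ws1 ++ ws2) v = wact ws1 (wact ws2 v).
Proof. by rewrite /wact foldr_cat. Qed.

Lemma wact_sum ws (r : seq 'rV[R]_n) F :
  wact ws (\sum_(a <- r) F a) = \sum_(a <- r) wact ws (F a).
Proof.
elim: r => [|a r IH]; last by rewrite !big_cons wactD IH.
by rewrite !big_nil -(scale0r (0 : 'rV[R]_n)) wactZ !scale0r.
Qed.

Lemma wact_dotp ws u v : 0 \notin ws ->
  dotp (wact ws u) (wact ws v) = dotp u v.
Proof.
elim: ws => //= a ws IH; rewrite inE negb_or eq_sym => /andP[ha hw].
by rewrite refl_dotp // IH.
Qed.

Lemma wact_refl ws a v : 0 \notin ws ->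
  wact ws (refl a v) = refl (wact ws a) (wact ws v).
Proof. by move=> h; rewrite /refl wactD wactN wactZ !wact_dotp. Qed.

Lemma wact_revK ws v : 0 \notin ws -> wact (rev ws) (wact ws v) = v.
Proof.
elim: ws v => //= a ws IH v; rewrite inE negb_or eq_sym => /andP[ha hw].
by rewrite rev_cons -cats1 wact_cat /= reflK ?IH.
Qed.

Lemma wactKrev ws v : 0 \notin ws -> wact ws (wact (rev ws) v) = v.
Proof. by move=> h; rewrite -{1}(revK ws) wact_revK // mem_rev. Qed.

Lemma nncomb0 (Pi : seq 'rV[R]_n) : nncomb Pi 0.
Proof. by exists (fun=> 0%N); rewrite big1 // => a _; rewrite scale0r. Qed.

Lemma nncombD (Pi : seq 'rV[R]_n) u v :
  nncomb Pi u -> nncomb Pi v -> nncomb Pi (u + v).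
Proof.
move=> [c ->] [d ->]; exists (fun a => c a + d a)%N.
by rewrite -big_split; apply: eq_bigr => a _; rewrite natrD scalerDl.
Qed.

Lemma nncombMn (Pi : seq 'rV[R]_n) k u : nncomb Pi u -> nncomb Pi (u *+ k).
Proof.
move=> h; elim: k => [|k IH]; rewrite ?mulr0n ?mulrS; first exact: nncomb0.
exact: nncombD.
Qed.

Lemma nncomb_sum (Pi r : seq 'rV[R]_n) F :
  (forall a, a \in r -> nncomb Pi (F a)) -> nncomb Pi (\sum_(a <- r) F a).
Proof.
by move=> h; rewrite big_seq; elim/big_ind: _ => //;
  [exact: nncomb0 | exact: nncombD].
Qed.

Lemma nncomb_ge0 (Pi : seq 'rV[R]_n) u v : nncomb Pi v ->
  (forall a, a \in Pi -> 0 <= dotp u a) -> 0 <= dotp u v.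
Proof.
move=> [c ->] h; rewrite dotp_sumr big_seq; apply: sumr_ge0 => a ha.
by rewrite dotpZr mulr_ge0 ?ler0n ?h.
Qed.

End Euclidean.

(** * Pairings and sums of roots *)

Section Roots.
Context {R : realFieldType} {n : nat} {D : seq 'rV[R]_n}.
Context (HD : root_system D).
Implicit Types (a b c g : 'rV[R]_n).

Lemma root_neq0 a : a \in D -> a != 0.
Proof. by case: HD => -[_ h _ _] _ ha; apply: contraNneq h => <-. Qed.

Lemma root_sq_gt0 a : a \in D -> 0 < dotp a a.
Proof. by move=> /root_neq0 /dotp_gt0. Qed.

Lemma root_refl a b : a \in D -> b \in D -> refl a b \in D.
Proof. by case: HD => -[_ _ _ h] _; apply: h. Qed.

Lemma root_opp a : a \in D -> - a \in D.
Proof. by move=> ha; rewrite -refl_self ?root_neq0 // root_refl. Qed.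

Lemma root_int a b : a \in D -> b \in D ->
  exists z : int, 2 * dotp b a = z%:~R * dotp a a.
Proof.
move=> ha hb; case: HD => _ [h _]; have [z hz] := h a b ha hb; exists z.
by rewrite -hz /cartan divfK // gt_eqF // root_sq_gt0.
Qed.

(** The pairing [z] is a negative integer. If [z <= -2], then [a + b] has squared norm at most 0, as
    [b] is no longer than [a]; otherwise [z = -1] and reflecting [b] in [a] gives [a + b]. *)
Lemma root_obtuse a b : a \in D -> b \in D -> dotp a b < 0 ->
  dotp b b <= dotp a a ->
  a + b = 0 \/ (2 * dotp a b = - dotp a a /\ refl a b = a + b).
Proof.
move=> ha hb hab hle; have [z hz] := root_int ha hb; have hp := root_sq_gt0 ha.
rewrite dotpC in hz.
have z0 : z < 0 by rewrite -(ltrz0 R) -(pmulr_llt0 _ hp) -hz; lra.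
have [z1|z1] := leP z (- 2%:Z).
  left; apply: dotp_eq0; rewrite !dotpE (dotpC b a).
  have : z%:~R <= - 2 :> R by rewrite -[- 2](_ : (- 2%:Z)%:~R = _) ?ler_int.
  by move: (z%:~R : R) hz => y hz hy; nra.
have {z0 z1} zE : z = -1 by lia.
right; rewrite hz zE mulrN1z mulNr mul1r; split=> //.
rewrite /refl (dotpC b) hz zE mulrN1z mulNr mul1r mulNr divff ?gt_eqF //.
by rewrite scaleN1r opprK addrC.
Qed.

Lemma root_add a b : a \in D -> b \in D -> dotp a b < 0 ->
  a + b = 0 \/ a + b \in D.
Proof.
move=> ha hb hab; have [hle|/ltW hle] := leP (dotp b b) (dotp a a).
  by have [|[_ <-]] := root_obtuse ha hb hab hle; [left | right; apply: root_refl].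
rewrite dotpC in hab; rewrite addrC.
by have [|[_ <-]] := root_obtuse hb ha hab hle; [left | right; apply: root_refl].
Qed.

Lemma root_sub a b : a \in D -> b \in D -> 0 < dotp a b -> a = b \/ a - b \in D.
Proof.
move=> ha hb hab.
have [|/eqP|] := root_add ha (root_opp hb); first by rewrite dotpNr; lra.
  by rewrite subr_eq0 => /eqP; left.
by right.
Qed.

(* The Jacobi identity of the associated Lie algebra, read off root spaces. *)
Lemma root_jacobi a b c : a \in D -> b \in D -> c \in D -> a + b \in D ->
  a + b + c \in D ->
  (a + c = 0 \/ a + c \in D) \/ (b + c = 0 \/ b + c \in D).
Proof.
move=> ha hb hc hab habc; apply: NNPP => /not_or_and [n1 n2].
have h1 : 0 <= dotp a c by rewrite leNgt; apply/negP => h; apply: n1; apply: root_add.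
have h2 : 0 <= dotp b c by rewrite leNgt; apply/negP => h; apply: n2; apply: root_add.
have h3 : dotp (a + b + c) a <= 0.
  rewrite leNgt; apply/negP => h; apply: n2.
  have -> : b + c = a + b + c - a by rewrite -(addrA a) (addrC a) addrK.
  by have [->|] := root_sub habc ha h; [left; rewrite subrr | right].
have h4 : dotp (a + b + c) b <= 0.
  rewrite leNgt; apply/negP => h; apply: n1.
  have -> : a + c = a + b + c - b by rewrite addrAC addrK.
  by have [->|] := root_sub habc hb h; [left; rewrite subrr | right].
(* The four inequalities add up to [dotp (a + b) (a + b) <= 0]. *)
have := root_sq_gt0 hab; move: h3 h4; rewrite !dotpE (dotpC b a) (dotpC c).
by rewrite (dotpC c b); lra.
Qed.

Lemma long_pairing a b : long D a -> b \in D -> 0 < dotp b a ->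
  b = a \/ 2 * dotp b a = dotp a a /\ b - a \in D.
Proof.
move=> [ha hl] hb hab.
have h : dotp a (- b) < 0 by rewrite dotpNr dotpC; lra.
have hle : dotp (- b) (- b) <= dotp a a by rewrite !dotpE opprK hl.
have [/eqP|[]] := root_obtuse ha (root_opp hb) h hle.
  by rewrite subr_eq0 => /eqP; left.
rewrite dotpNr dotpC => h1 h2; right; split; first by lra.
by rewrite -opprB -h2 root_opp // root_refl // root_opp.
Qed.

(** The usual way below to identify a root: a pairing above 1 with a long root leaves no choice. *)
Lemma long_pairing_gt a b : long D a -> b \in D -> dotp a a < 2 * dotp b a ->
  b = a.
Proof.
move=> hl hb h; have hp := root_sq_gt0 hl.1.
have h1 : 0 < dotp b a by lra.
by have [//|[h2 _]] := long_pairing hl hb h1; exfalso; lra.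
Qed.

Lemma long_pairingN a b : long D a -> b \in D -> dotp b a < 0 ->
  b = - a \/ [/\ 2 * dotp b a = - dotp a a, refl a b = b + a & b + a \in D].
Proof.
move=> [ha hl] hb hab; rewrite dotpC in hab.
have [/eqP|[h1 h2]] := root_obtuse ha hb hab (hl b hb).
  by rewrite addrC addr_eq0 => /eqP; left.
by right; rewrite dotpC h1 h2 addrC; split=> //; rewrite addrC -h2 root_refl.
Qed.

(** * Simple coefficients and positive roots *)

Context {Pi : seq 'rV[R]_n} (HPi : is_base D Pi).
Local Notation "g '>+'" := (posroot D Pi g) (at level 70).

(** The indicator relabels [coord], which is indexed by ordinals, by the simple roots themselves;
    the value is 0 when [a] is not simple. *)
Definition scoef a (v : 'rV[R]_n) : R :=
  \sum_(i < size Pi) (Pi`_i == a)%:R * coord (in_tuple Pi) i v.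

Lemma scoefD a u v : scoef a (u + v) = scoef a u + scoef a v.
Proof. by rewrite -big_split; apply: eq_bigr => i _; rewrite linearD mulrDr. Qed.

Lemma scoefZ a k v : scoef a (k *: v) = k * scoef a v.
Proof.
by rewrite /scoef big_distrr; apply: eq_bigr => i _; rewrite linearZ mulrCA.
Qed.

Lemma scoefN a v : scoef a (- v) = - scoef a v.
Proof. by rewrite -scaleN1r scoefZ mulN1r. Qed.

Lemma scoef0 a : scoef a 0 = 0.
Proof. by rewrite -(scale0r 0) scoefZ mul0r. Qed.

Lemma base_root a : a \in Pi -> a \in D.
Proof. by case: HPi => _ h _ _; apply: h. Qed.

Lemma base_pos a : a \in Pi -> a >+.
Proof.
move=> ha; split; first exact: base_root.
exists (fun b => (b == a) : nat); case: HPi => hu _ _ _.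
rewrite (bigD1_seq a) //= eqxx scale1r big1 ?addr0 // => b /negPf ->.
by rewrite scale0r.
Qed.

Lemma scoef_base a b : a \in Pi -> scoef a b = (b == a)%:R \/ b \notin Pi.
Proof.
move=> ha; have [hb|] := boolP (b \in Pi); last by right.
left; case: HPi => hu _ hf _; move: hb => /nthP -/(_ 0) [i hi <-].
have hfr : free (in_tuple Pi) by [].
rewrite /scoef (bigD1 (Ordinal hi)) //= big1 => [|j hj].
  by rewrite addr0 (coord_free (Ordinal hi)) // eqxx mulr1.
by rewrite (coord_free (Ordinal hi) j hfr) // [_ == j]eq_sym (negPf hj) mulr0.
Qed.

Lemma scoef_bb a b : a \in Pi -> b \in Pi -> scoef a b = (b == a)%:R.
Proof. by move=> ha hb; case: (scoef_base b ha) => //; rewrite hb. Qed.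

Lemma scoef_comb a (c : 'rV[R]_n -> R) : a \in Pi ->
  scoef a (\sum_(b <- Pi) c b *: b) = c a.
Proof.
move=> ha; have hu : uniq Pi by case: HPi.
rewrite (bigD1_seq a) //= scoefD scoefZ scoef_bb // eqxx mulr1 big_seq_cond.
rewrite [X in scoef _ X](_ : _ = \sum_(b <- Pi | (b \in Pi) && (b != a)) c b *: b) //.
have -> : scoef a (\sum_(b <- Pi | (b \in Pi) && (b != a)) c b *: b) = 0.
  apply: (big_ind (fun v => scoef a v = 0)); first exact: scoef0.
  - by move=> u v hu' hv; rewrite scoefD hu' hv addr0.
  - by move=> b /andP[hb /negPf hne]; rewrite scoefZ scoef_bb // hne mulr0.
by rewrite addr0.
Qed.

Lemma nncombP v : nncomb Pi v -> exists2 c : 'rV[R]_n -> nat,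
  v = \sum_(b <- Pi) scoef b v *: b & forall a, a \in Pi -> scoef a v = (c a)%:R.
Proof.
move=> [c hc]; have h a : a \in Pi -> scoef a v = (c a)%:R.
  by move=> ha; rewrite hc scoef_comb.
exists c => //; rewrite {1}hc; apply: eq_big_seq => a ha.
by rewrite h.
Qed.

Lemma scoef_ge0 a v : nncomb Pi v -> a \in Pi -> 0 <= scoef a v.
Proof. by move=> /nncombP[c _ h] ha; rewrite h. Qed.

Lemma nncomb_eq0 v : nncomb Pi v -> (forall a, a \in Pi -> scoef a v <= 0) -> v = 0.
Proof.
move=> hv h; have [c -> _] := nncombP hv; rewrite big_seq big1 // => a ha.
have -> : scoef a v = 0 by apply/eqP; rewrite eq_le h // scoef_ge0.
by rewrite scale0r.
Qed.

Lemma nncomb_anti v : nncomb Pi v -> nncomb Pi (- v) -> v = 0.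
Proof.
move=> h1 h2; apply: nncomb_eq0 => // a ha.
by have := scoef_ge0 h2 ha; rewrite scoefN oppr_ge0.
Qed.

Lemma pos_neq0 g : g >+ -> g <> 0.
Proof. by case=> /root_neq0 /eqP. Qed.

Lemma pos_anti g : g >+ -> ~ nncomb Pi (- g).
Proof. by move=> h h2; apply: (pos_neq0 h); apply: nncomb_anti => //; case: h. Qed.

Lemma root_pos g : g \in D -> g >+ \/ (- g) >+.
Proof.
move=> hg; case: HPi => _ _ _ h; have [h1|h1] := h _ hg; first by left.
by right; split=> //; apply: root_opp.
Qed.

Lemma pos_coef g a : g \in D -> a \in Pi -> 0 < scoef a g -> g >+.
Proof.
move=> hg ha hc; have [//|[_ h]] := root_pos hg.
by have := scoef_ge0 h ha; rewrite scoefN; lra.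
Qed.

Lemma posD g1 g2 : g1 >+ -> g2 >+ -> g1 + g2 \in D -> (g1 + g2) >+.
Proof. by move=> [_ h1] [_ h2] h; split=> //; apply: nncombD. Qed.

Lemma posD_neq0 g1 g2 : g1 >+ -> g2 >+ -> g1 + g2 <> 0.
Proof.
move=> h1 [_ h2] /eqP; rewrite addr_eq0 => /eqP e; apply: (pos_anti h1).
by rewrite e opprK.
Qed.

Lemma base_obtuse a b : a \in Pi -> b \in Pi -> a != b -> dotp a b <= 0.
Proof.
move=> ha hb hne; rewrite leNgt; apply/negP => h.
have [e|hd] := root_sub (base_root ha) (base_root hb) h; first by rewrite e eqxx in hne.
have [[_ h1]|[_ h1]] := root_pos hd.
  have := scoef_ge0 h1 hb; rewrite scoefD scoefN !scoef_bb // eqxx (negPf hne).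
  by rewrite mulr0n mulr1n; lra.
have := scoef_ge0 h1 ha; rewrite !(scoefD, scoefN) !scoef_bb // eqxx.
by rewrite [b == a]eq_sym (negPf hne) mulr0n mulr1n; lra.
Qed.

Lemma scoef0_obtuse v a : nncomb Pi v -> a \in Pi -> scoef a v = 0 -> dotp v a <= 0.
Proof.
move=> hv ha h0; have [c -> hc] := nncombP hv; rewrite dotpC dotp_sumr.
rewrite big_seq; apply: sumr_le0 => b hb; rewrite dotpZr.
have [->|hne] := eqVneq b a; first by rewrite h0 mul0r.
by rewrite mulr_ge0_le0 ?scoef_ge0 // base_obtuse // eq_sym.
Qed.

Lemma pos_acute g : g >+ -> exists2 a, a \in Pi & 0 < dotp g a.
Proof.
move=> [hg hp]; apply: NNPP => h.
have : 0 <= dotp (- g) g.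
  apply: (nncomb_ge0 hp) => a ha; rewrite dotpNl oppr_ge0 leNgt; apply/negP => h1.
  by apply: h; exists a.
by have := root_sq_gt0 hg; rewrite dotpNl; lra.
Qed.

(** Only the coefficient at [a] changes, so a positive coefficient elsewhere survives. If there is
    none, [g] is a multiple of [a], hence [a] itself since the system is reduced. *)
Lemma base_refl_pos a g : a \in Pi -> g >+ -> g <> a -> refl a g >+.
Proof.
move=> ha hg hne; have hr := root_refl (base_root ha) hg.1.
have [[b hb /andP[hba hc]]|hn] :=
  classic (exists2 b, b \in Pi & (b != a) && (0 < scoef b g)).
  apply: (pos_coef hr hb).
  by rewrite scoefD scoefN scoefZ (scoef_bb hb ha) eq_sym (negPf hba) mulr0 subr0.
have e : g = scoef a g *: a.
  have [c e _] := nncombP hg.2; have hu : uniq Pi by case: HPi.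
  rewrite {1}e; move: e => _.
  rewrite (bigD1_seq a) //= big_seq_cond big1 ?addr0 // => b /andP[hb hba].
  have -> : scoef b g = 0; last by rewrite scale0r.
  apply/eqP; rewrite eq_le (scoef_ge0 hg.2 hb) andbT leNgt; apply/negP => hc.
  by apply: hn; exists b; rewrite ?hba.
case: HD => _ [_ hred]; have hg1 := hg.1; rewrite e in hg1.
have [h|h] := hred _ _ (base_root ha) hg1; rewrite h in e.
  by case: hne; rewrite e scale1r.
by case: (pos_anti hg); rewrite e scaleN1r opprK; case: (base_pos ha).
Qed.

(** * Heights and adding simple roots *)

Definition height v : R := \sum_(a <- Pi) scoef a v.

Lemma heightD u v : height (u + v) = height u + height v.
Proof. by rewrite -big_split; apply: eq_bigr => a _; rewrite scoefD. Qed.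

Lemma heightN v : height (- v) = - height v.
Proof. by rewrite /height -sumrN; apply: eq_bigr => a _; rewrite scoefN. Qed.

Lemma heightZ k v : height (k *: v) = k * height v.
Proof. by rewrite /height big_distrr; apply: eq_bigr => a _; rewrite scoefZ. Qed.

Lemma height_nat v : nncomb Pi v -> exists m : nat, height v = m%:R.
Proof.
move=> /nncombP[c _ h]; exists (\sum_(a <- Pi) c a)%N; rewrite natr_sum.
by apply: eq_big_seq => a /h.
Qed.

Lemma height_base a : a \in Pi -> height a = 1.
Proof.
move=> ha; have hu : uniq Pi by case: HPi.
rewrite /height (bigD1_seq a) //= scoef_bb // eqxx big_seq_cond big1 ?addr0 //.
by move=> b /andP[hb hne]; rewrite scoef_bb // eq_sym (negPf hne).
Qed.

Lemma pos_height g : g >+ -> 1 <= height g.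
Proof.
move=> hg; have [m hm] := height_nat hg.2; rewrite hm ler1n lt0n.
apply/eqP => m0; apply: (pos_neq0 hg); apply: nncomb_eq0 hg.2 _ => a ha.
have hu : uniq Pi by case: HPi.
have : height g <= 0 by rewrite hm m0.
rewrite /height (bigD1_seq a) //= big_seq_cond; apply: le_trans.
by rewrite lerDl; apply: sumr_ge0 => b /andP[hb _]; apply: scoef_ge0 hb; case: hg.
Qed.

Lemma base_indec a g1 g2 : a \in Pi -> g1 >+ -> g2 >+ -> a <> g1 + g2.
Proof.
move=> ha h1 h2 e; have := height_base ha; rewrite e heightD.
by have := pos_height h1; have := pos_height h2; lra.
Qed.

Lemma base_sub_pos a g : a \in Pi -> g >+ -> g - a \in D -> (g - a) >+.
Proof.
move=> ha hg hd; have [//|hn] := root_pos hd.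
by case: (base_indec ha hg hn); rewrite opprB addrC subrK.
Qed.

(** Subtract from [nu] a simple root [a] at an acute angle. By [root_jacobi], [g + a] or
    [g + (nu - a)] is a root; in the second case induct on the height of [nu]. *)
Lemma simple_add g nu : g >+ -> nu >+ -> g + nu \in D ->
  exists2 a, a \in Pi & g + a \in D.
Proof.
move=> hg hnu; have [m hm] := height_nat hnu.2.
have {hm} : height nu < m.+1%:R by rewrite hm ltr_nat.
elim: m.+1 nu hnu => [|k IH] nu hnu hk hs.
  by have [m' e] := height_nat hnu.2; move: hk; rewrite e ltr_nat.
have [a ha hac] := pos_acute hnu.
have [e|hd] := root_sub hnu.1 (base_root ha) hac; first by exists a; rewrite // -e.
have hpa := base_pos ha; have hp := base_sub_pos ha hnu hd.
have h1 : a + (nu - a) \in D by rewrite addrC subrK; case: hnu.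
have h2 : a + (nu - a) + g \in D by rewrite [a + _]addrC subrK addrC.
have [[|h]|[|h]] := root_jacobi hpa.1 hd hg.1 h1 h2.
- by move=> h; case: (posD_neq0 hpa hg h).
- by exists a; rewrite // addrC.
- by move=> h; case: (posD_neq0 hp hg h).
apply: IH hp _ _; last by rewrite addrC.
by rewrite heightD heightN (height_base ha); move: hk; rewrite -natr1; lra.
Qed.

(** * The highest root: dominance and length *)

Context {th : 'rV[R]_n} (Hth : highest_root D Pi th).

Lemma th_root : th \in D. Proof. by case: Hth. Qed.

Lemma th_dom a : a \in Pi -> 0 <= dotp th a.
Proof.
move=> ha; rewrite leNgt; apply/negP => h; case: Hth => hth hmax.
have [|h1] := root_add hth (base_root ha) h.
  move=> /eqP; rewrite addr_eq0 => /eqP e.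
  have := hmax _ (base_root ha); rewrite e -opprD => h1.
  have hp := base_pos ha; apply: (@pos_anti a hp).
  by have := nncombD h1 hp.2; rewrite opprD addrNK.
have := hmax _ h1; rewrite opprD addNKr; exact: pos_anti (base_pos ha).
Qed.

Lemma pos_dom g : g >+ -> 0 <= dotp g th.
Proof. by move=> hg; rewrite dotpC; apply: nncomb_ge0 hg.2 th_dom. Qed.

Lemma acute_pos g : g \in D -> 0 < dotp g th -> g >+.
Proof.
move=> hg h; have [//|/pos_dom] := root_pos hg; rewrite dotpNl; lra.
Qed.

Lemma th_pos : th >+.
Proof. by apply: acute_pos th_root _; apply: root_sq_gt0 th_root. Qed.

Lemma dominant_le g : g >+ -> (forall a, a \in Pi -> 0 <= dotp g a) ->
  dotp g g <= dotp g th /\ dotp g th <= dotp th th.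
Proof.
move=> hg hdom; have h1 := (Hth.2 _ hg.1); split.
  by have := nncomb_ge0 h1 hdom; rewrite !dotpE; lra.
by have := nncomb_ge0 h1 th_dom; rewrite !dotpE (dotpC th g); lra.
Qed.

(* Reflecting in a simple root at an obtuse angle climbs towards [th]. *)
Lemma climb_ind (P : 'rV[R]_n -> Prop) :
  (forall g, g >+ -> (forall a, a \in Pi -> 0 <= dotp g a) -> P g) ->
  (forall g a, g >+ -> a \in Pi -> dotp g a < 0 -> P (refl a g) -> P g) ->
  forall g, g >+ -> P g.
Proof.
move=> Pdom Pref g hg.
have [m hm] := height_nat (Hth.2 _ hg.1).
have {hm} : height (th - g) < m.+1%:R by rewrite hm ltr_nat.
elim: m.+1 g hg => [|k IH] g hg hk.
  by have [m' e] := height_nat (Hth.2 _ hg.1); move: hk; rewrite e ltr_nat.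
have [|hn] := classic (forall a, a \in Pi -> 0 <= dotp g a); first exact: Pdom.
have {hn} [a ha hlt] : exists2 a, a \in Pi & dotp g a < 0.
  apply: NNPP => h; apply: hn => a ha; rewrite leNgt; apply/negP => h'.
  by apply: h; exists a.
have hne : g <> a.
  by move=> e; move: hlt; rewrite e; have := root_sq_gt0 (base_root ha); lra.
have hp := base_refl_pos ha hg hne.
apply: (Pref g a) => //; apply: IH hp _.
have [z hz] := root_int (base_root ha) hg.1.
have sa := root_sq_gt0 (base_root ha).
have hr : refl a g = g - z%:~R *: a.
  by rewrite /refl hz mulfK // gt_eqF.
have z0 : z < 0 by rewrite -(ltrz0 R) -(pmulr_llt0 _ sa) -hz; lra.
(* An integer pairing at most -1 means that the reflection raises the height by at least 1, as the
   induction requires. *)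
have z1 : z%:~R <= -1 :> R by rewrite -(mulrN1z 1) ler_int; lia.
rewrite hr; move: hk; rewrite !(heightD, heightN, heightZ, height_base ha) -natr1; lra.
Qed.

(** Climbing preserves length and ends at a dominant root, to which [dominant_le] applies. *)
Lemma th_long : long D th.
Proof.
split; first exact: th_root.
have h g : g >+ -> dotp g g <= dotp th th.
  move: g; apply: climb_ind => [g hg hd|g a hg ha _].
    by have [h1 h2] := dominant_le hg hd; apply: le_trans h1 h2.
  by rewrite refl_dotp // root_neq0 // base_root.
move=> b hb; have [/h //|/h] := root_pos hb; by rewrite dotpNl dotpNr opprK.
Qed.

(** * Words in simple reflections and minimal representatives *)

Lemma word_neq0 ws : word Pi ws -> 0 \notin ws.
Proof. by move=> h; apply/negP => /h /base_root /root_neq0; rewrite eqxx. Qed.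

Lemma word_rev ws : word Pi ws -> word Pi (rev ws).
Proof. by move=> h a; rewrite mem_rev; apply: h. Qed.

Lemma word_cat ws1 ws2 : word Pi ws1 -> word Pi ws2 -> word Pi (ws1 ++ ws2).
Proof. by move=> h1 h2 a; rewrite mem_cat => /orP[/h1|/h2]. Qed.

Lemma word_cons a ws : a \in Pi -> word Pi ws -> word Pi (a :: ws).
Proof. by move=> h1 h2 b; rewrite inE => /orP[/eqP->|/h2]. Qed.

Lemma wact_root ws g : word Pi ws -> g \in D -> wact ws g \in D.
Proof.
elim: ws => //= a ws IH hw hg; apply: root_refl.
  by apply: base_root; apply: hw; rewrite inE eqxx.
by apply: IH hg => b hb; apply: hw; rewrite inE hb orbT.
Qed.

(** Climb from [g] and record the reflections. A dominant long root equals [th], because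
    [dominant_le] forces the norm of [th - g] to vanish. *)
Lemma long_word g : g >+ -> long D g -> exists2 ws, word Pi ws & wact ws th = g.
Proof.
move: g; apply: climb_ind => [g hg hd|g a hg ha hlt IH] hl.
  exists [::] => //=; apply/eqP; rewrite -subr_eq0; apply/eqP; apply: dotp_eq0.
  have [h1 h2] := dominant_le hg hd; have := hl.2 _ th_root; have := th_long.2 _ hg.1.
  by rewrite !dotpE (dotpC th g); lra.
have a0 := root_neq0 (base_root ha).
have [|ws hw e] := IH.
  split=> [|b hb]; first by apply: root_refl (base_root ha) hg.1.
  by rewrite refl_dotp //; apply: hl.2.
by exists (a :: ws); [apply: word_cons | rewrite wact_cons e reflK].
Qed.

Lemma minword_ex g : g >+ -> long D g -> exists ws, minword Pi th g ws.
Proof.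
move=> hg hl; have [ws hw e] := long_word hg hl.
elim: {ws}(size ws).+1 {-2}ws (ltnSn (size ws)) hw e => // k IH ws hk hw e.
have [h|h] := classic
    (exists ws', [/\ word Pi ws', wact ws' th = g & (size ws' < size ws)%N]).
  by have [ws' [h1 h2 h3]] := h; apply: IH h1 h2; apply: leq_trans h3 _.
exists ws; split=> // ws' h1 h2; rewrite leqNgt; apply/negP => h3.
by apply: h; exists ws'.
Qed.

(** Exchange condition: at the letter [b] where the image of [a] turns negative, this image is [b]
    itself, and that letter can be deleted. *)
Lemma exchange ws a : word Pi ws -> a \in Pi -> (- wact ws a) >+ ->
  exists ws', [/\ word Pi ws', (size ws').+1 = size ws &
    forall v, wact ws' v = wact ws (refl a v)].
Proof.
move=> + ha; elim: ws => [_ /= [_ /pos_anti]|b ws IH hw /= hn].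
  by move=> h; case: h; apply: base_pos.
have hb : b \in Pi by apply: hw; rewrite inE eqxx.
have {}hw : word Pi ws by move=> c hc; apply: hw; rewrite inE hc orbT.
have [hp|hp] := root_pos (wact_root hw (base_root ha)); last first.
  have [ws' [h1 h2 h3]] := IH hw hp; exists (b :: ws'); split=> [||v] /=.
  - exact: word_cons.
  - by rewrite h2.
  - by rewrite h3.
have e : wact ws a = b.
  by apply: NNPP => /(base_refl_pos hb hp) h; case: (pos_anti h); case: hn.
exists ws; split=> // v; rewrite wact_refl ?word_neq0 // e reflK //.
by rewrite root_neq0 // base_root.
Qed.

(** The letters before the last letter [a] must make [a] negative, so [exchange] yields a word with
    the same action that is shorter by two. *)
Lemma pos_preserving_id ws : word Pi ws ->
  (forall g, g >+ -> wact ws g >+) -> forall v, wact ws v = v.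
Proof.
elim: {ws}(size ws).+1 {-2}ws (ltnSn (size ws)) => // k IH ws hk hw hp v.
case/lastP: ws => [//|ws a] in hk hw hp *.
have ha : a \in Pi by apply: hw; rewrite mem_rcons inE eqxx.
have hw' : word Pi ws by move=> c hc; apply: hw; rewrite mem_rcons inE hc orbT.
have eW u : wact (rcons ws a) u = wact ws (refl a u) by rewrite -cats1 wact_cat.
have hn : (- wact ws a) >+.
  have := hp _ (base_pos ha); rewrite eW refl_self ?wactN //.
  by rewrite root_neq0 // base_root.
have [ws' [h1 h2 h3]] := exchange hw' ha hn.
rewrite eW -h3; apply: IH => // [|g hg].
  by move: hk; rewrite size_rcons -h2 !ltnS => /ltnW.
by rewrite h3 -eW; apply: hp.
Qed.

(** Characterises the minimal coset representative without mentioning length, so that it can be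
    checked for words that need not be reduced. *)
Definition good a ws : Prop := [/\ word Pi ws, wact ws th = a &
  forall g, g >+ -> dotp g th = 0 -> wact ws g >+].

Lemma good_dotp a ws g : good a ws -> dotp (wact ws g) a = dotp g th.
Proof. by case=> hw <- _; rewrite wact_dotp // word_neq0. Qed.

(** As [th] is dominant, a positive root orthogonal to [th] only involves simple roots orthogonal to
    [th]. If one of these became negative, [exchange] would give a shorter word still sending [th]
    to [a]. *)
Lemma minword_good a ws : minword Pi th a ws -> good a ws.
Proof.
case=> hw e hmin; split=> // g hg h0.
have [//|hn] := root_pos (wact_root hw hg.1).
suff [b [hb hb0 hbn]] : exists b, [/\ b \in Pi, dotp th b = 0 & (- wact ws b) >+].
  have [ws' [h1 h2 h3]] := exchange hw hb hbn.
  have := hmin ws' h1; rewrite h3 refl_orth // => /(_ e).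
  by rewrite -h2 ltnn.
apply: NNPP => hb; apply: (pos_anti hn); rewrite opprK.
have [c hc hcn] := nncombP hg.2; rewrite hc wact_sum; apply: nncomb_sum => b hbPi.
rewrite wactZ (hcn b hbPi) scaler_nat.
have [->|c0] := eqVneq (c b) 0%N; first by rewrite mulr0n; apply: nncomb0.
apply: nncombMn.
have hbth : dotp th b = 0.
  move: h0; rewrite dotpC hc dotp_sumr big_seq => /eqP.
  rewrite psumr_eq0 => [|d hd]; last first.
    by rewrite dotpZr mulr_ge0 ?th_dom // scoef_ge0 //; case: hg.
  move=> /allP /(_ b hbPi); rewrite hbPi /= dotpZr (hcn b hbPi) mulf_eq0.
  by rewrite pnatr_eq0 (negPf c0) => /eqP.
have [[]//|h] := root_pos (wact_root hw (base_root hbPi)).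
by case: hb; exists b.
Qed.

Lemma good_ex a : a \in Pi -> long D a -> exists ws, good a ws.
Proof.
move=> /base_pos ha hl; have [ws h] := minword_ex ha hl.
by exists ws; apply: minword_good.
Qed.

(* [wact ws] sends [Delta^+] onto the positive system consisting of the roots
   [b] with [(b, a) > 0] and the positive roots orthogonal to [a]; the latter
   depends only on [a]. *)
Lemma good_uniq a ws1 ws2 : good a ws1 -> good a ws2 ->
  forall v, wact ws1 v = wact ws2 v.
Proof.
move=> g1 g2 v; have [hw1 e1 p1] := g1; have [hw2 e2 p2] := g2.
suff h : wact (rev ws2 ++ ws1) v = v.
  by rewrite -[LHS](wactKrev _ (word_neq0 hw2)) -(wact_cat (rev ws2)) h.
apply: pos_preserving_id => [|g hg]; first exact: word_cat (word_rev hw2) hw1.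
rewrite wact_cat; set h := wact _ _.
have eh : wact ws2 h = wact ws1 g by rewrite /h wactKrev // word_neq0.
have hD : h \in D by apply: wact_root (word_rev hw2) _; apply: wact_root hw1 hg.1.
have hdot : dotp h th = dotp g th by rewrite -(good_dotp h g2) eh (good_dotp g g1).
have [h0|h0] := eqVneq (dotp g th) 0; last first.
  by apply: acute_pos hD _; rewrite hdot lt_neqAle eq_sym h0 pos_dom.
have [//|hn] := root_pos hD.
have := p2 _ hn; rewrite dotpNl hdot h0 oppr0 => /(_ erefl).
by rewrite wactN eh => -[_ /(pos_anti (p1 _ hg h0))].
Qed.

(** * Explicit forms of I(a)_min and I(a)_max *)

Lemma pos_long_sub a g : a \in Pi -> long D a -> g >+ -> 0 < dotp g a -> g <> a ->
  (g - a) >+.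
Proof.
move=> ha hl hg h hne; have [//|[_]] := long_pairing hl hg.1 h.
exact: base_sub_pos.
Qed.

Lemma th_sub g : g \in D -> 0 < dotp g th -> g <> th ->
  (th - g) >+ /\ 0 < dotp (th - g) th.
Proof.
move=> hg h hne; have [//|[e hd]] := long_pairing th_long hg h.
have : 0 < dotp (th - g) th.
  by rewrite dotpDl dotpNl; have := root_sq_gt0 th_root; lra.
by split=> //; apply: acute_pos => //; rewrite -opprB root_opp.
Qed.

(** If [g] is not dominant, add a simple root at an obtuse angle. If it is, [g] lies in H, so
    [th - g] is a positive root and [simple_add] applies. *)
Lemma th_climb g : g >+ -> g <> th -> exists2 s, s \in Pi & g + s \in D.
Proof.
move=> hg hne.
have [|hn] := classic (forall a, a \in Pi -> 0 <= dotp g a) => [hdom|]; last first.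
  have [s hs hlt] : exists2 s, s \in Pi & dotp g s < 0.
    apply: NNPP => h; apply: hn => s hs; rewrite leNgt; apply/negP => h'.
    by apply: h; exists s.
  exists s => //; have [h|//] := root_add hg.1 (base_root hs) hlt.
  by case: (posD_neq0 hg (base_pos hs)).
have [h1 _] := dominant_le hg hdom.
have h2 : 0 < dotp g th by apply: lt_le_trans h1; apply: root_sq_gt0; case: hg.
have [h3 _] := th_sub hg.1 h2 hne.
by apply: simple_add hg h3 _; rewrite addrC subrK th_root.
Qed.

(** For [x = th - g] the images of [x] and [g] add up to the simple root [a], so exactly one of them
    is positive. *)
Lemma IminP a ws x : a \in Pi -> long D a -> good a ws ->
  Imin D Pi th a x <-> [/\ x >+, 0 < dotp x th & wact ws x >+].
Proof.
move=> ha hl hg; have [hw e hp] := hg; have hpa := base_pos ha; split.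
  move=> [ws' [/minword_good hg' hx]].
  have hE := good_uniq hg' hg.
  case: hx => [->|[g [[h1 h2] ->]]].
    by rewrite e; split=> //; [apply: th_pos | apply: root_sq_gt0 th_root].
  rewrite hE in h2.
  have h0 : 0 < dotp g th.
    rewrite lt_neqAle pos_dom // andbT eq_sym; apply/eqP => h0.
    by case: h2 => _; apply: pos_anti; apply: hp.
  have hne : g <> th by move=> eg; case: h2 => _; rewrite eg e; apply: pos_anti.
  have [h3 h4] := th_sub h1.1 h0 hne; split=> //.
  split; first by apply: wact_root hw h3.1.
  by rewrite wactD wactN e; apply: nncombD; [case: hpa | case: h2].
move=> [h1 h2 h3]; have [ws' hm] := minword_ex hpa hl.
exists ws'; split=> //; have hE := good_uniq (minword_good hm) hg.
have [->|/eqP hne] := eqVneq x th; first by left.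
right; exists (th - x); have [h4 h5] := th_sub h1.1 h2 hne.
split; last by rewrite opprB addrC subrK.
split=> //; rewrite hE wactD wactN e opprB; apply: pos_long_sub => //.
  by rewrite (good_dotp _ hg).
move=> h; apply: hne; rewrite -(wact_revK x (word_neq0 hw)) h -e.
by rewrite wact_revK // word_neq0.
Qed.

(* The positive [g] with [K0 a g] form the image under [w_a] of the part of
   [I(a)_max] orthogonal to [th]. *)
Definition K0 a g : Prop :=
  dotp g a = 0 /\ forall b, b >+ -> 0 < dotp b a -> b + g \notin D.

(** If [b + (nu + g)] were a root, [root_jacobi] would make [g + b] or [nu + b] a root. The latter
    also pairs positively with [a], and adding [g] to it gives a root. *)
Lemma K0D a g nu : K0 a g -> g >+ -> nu >+ -> dotp nu a = 0 -> nu + g \in D ->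
  K0 a (nu + g).
Proof.
move=> [h0 hK] hg hnu hnu0 hd; split; first by rewrite dotpDl h0 hnu0 addr0.
move=> b hb hba; apply/negP => hbd.
have [[h|h]|[h|h]] : (nu + b = 0 \/ nu + b \in D) \/ (g + b = 0 \/ g + b \in D).
- by apply: root_jacobi => //; [case: hnu|case: hg|case: hb|rewrite addrC].
- by case: (posD_neq0 hnu hb).
- have hp := posD hnu hb h.
  have := hK _ hp; rewrite dotpDl hnu0 add0r => /(_ hba).
  by rewrite addrAC [_ + b]addrC hbd.
- by case: (posD_neq0 hg hb).
by have := hK b hb hba; rewrite addrC h.
Qed.

(** If [dotp s a < 0], then [s + a] is a positive root pairing positively with [a], and [g + s + a]
    is a root, against [K0]. *)
Lemma K0_step a g s : long D a -> K0 a g -> g >+ -> a \in Pi -> s \in Pi ->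
  g + s \in D -> dotp s a = 0.
Proof.
move=> hl hK hg ha hs hd; have [h0 hK'] := hK; have hps := base_pos hs.
have hpa := base_pos ha; have sa := root_sq_gt0 hpa.1.
have hne : s <> a by move=> e; have := hK' a hpa sa; rewrite addrC -e hd.
apply/eqP; rewrite eq_le base_obtuse //=; last exact/eqP.
rewrite leNgt; apply/negP => hsa.
have [e|[e _ hsum]] := long_pairingN hl hps.1 hsa.
  by apply: (pos_anti hpa); rewrite -e; case: hps.
have hp := posD hps hpa hsum.
have := hK' _ hp; rewrite dotpDl => /(_ _) /negP; case; first by lra.
have hgs : 0 > dotp (g + s) a by rewrite dotpDl h0; lra.
have [e'|[_ _]] := long_pairingN hl hd hgs; last by rewrite [s + a + g]addrC addrA.
case: (posD_neq0 (posD hg hps hd) hpa); by rewrite e' addNr.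
Qed.

(** By [K0_step] and [K0D] the climb of [th_climb] stays inside [K0], so a property can be carried
    from [th] down to [g]. *)
Lemma K0_ind a (P : 'rV[R]_n -> Prop) : long D a -> a \in Pi ->
  P th ->
  (forall g s, g >+ -> s \in Pi -> (g + s) >+ -> dotp s a = 0 -> P (g + s) -> P g) ->
  forall g, g >+ -> K0 a g -> P g.
Proof.
move=> hl ha Pth Ps g hg; have [m hm] := height_nat (Hth.2 _ hg.1).
have {hm} : height (th - g) < m.+1%:R by rewrite hm ltr_nat.
elim: m.+1 g hg => [|k IH] g hg hk hK.
  by have [m' e] := height_nat (Hth.2 _ hg.1); move: hk; rewrite e ltr_nat.
have [->//|/eqP hne] := eqVneq g th.
have [s hs hd] := th_climb hg hne.
have hs0 := K0_step hl hK hg ha hs hd.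
have hp := posD hg (base_pos hs) hd.
apply: (Ps g s) => //; apply: IH => //; last first.
  by rewrite addrC; apply: K0D (base_pos hs) hs0 _; rewrite // addrC.
by move: hk; rewrite !(heightD, heightN, height_base hs) -natr1; lra.
Qed.

Lemma K0_coef a g : long D a -> a \in Pi -> g >+ -> K0 a g ->
  scoef a g = scoef a th.
Proof.
move=> hl ha; move: g; apply: (K0_ind hl ha) => // g s _ hs _ hsa.
rewrite scoefD (scoef_bb ha hs) => <-; have [e|_] := eqVneq s a; last by rewrite addr0.
by move: hsa; rewrite e; have := root_sq_gt0 (base_root ha); lra.
Qed.

Lemma K0_th a g : long D a -> a \in Pi -> g >+ -> K0 a g -> dotp th a = 0.
Proof.
move=> hl ha hg hK; rewrite -hK.1; have := hK; move: g hg {hK}.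
move=> g hg hK; symmetry.
suff : forall g, g >+ -> K0 a g -> dotp g a = dotp th a by apply.
by apply: (K0_ind hl ha) => // g' s _ _ _ h0; rewrite dotpDl h0 addr0.
Qed.

Lemma th_coef a : a \in Pi -> 1 <= scoef a th.
Proof.
move=> ha; have := scoef_ge0 (Hth.2 _ (base_root ha)) ha.
by rewrite scoefD scoefN (scoef_bb ha ha) eqxx subr_ge0.
Qed.

(** Explicit candidate for I(a)_max. For good [ws] and [x] orthogonal to [th], positivity of the
    image is automatic. *)
Definition Imax_set a ws x : Prop :=
  [/\ x >+, wact ws x >+ & 0 < dotp x th \/ K0 a (wact ws x)].

Lemma Imax_set_ideal a ws : a \in Pi -> long D a -> good a ws ->
  Imin_ideal D Pi th a (Imax_set a ws).
Proof.
move=> ha hl hg; have [hw e hp] := hg; have hpa := base_pos ha.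
have sth := root_sq_gt0 th_root.
have eth : dotp a a = dotp th th by rewrite -e wact_dotp // word_neq0.
have thP g : g \in D -> dotp th th < 2 * dotp g th -> wact ws g = a.
  by move=> h1 h2; rewrite (long_pairing_gt th_long h1 h2).
have dotge g : g >+ -> 0 < dotp g th -> dotp th th <= 2 * dotp g th.
  by move=> h1 h2; have [->|[-> _]] := long_pairing th_long h1.1 h2; lra.
split; last 1 first.
- move=> x; rewrite (IminP _ ha hl hg); split.
    by move=> [[h1 h2 _] [_ h3]].
  by move=> [h1 h2 h3]; split; split=> //; left.
- split; first split; first by move=> g [].
  + move=> x nu [hx hwx hor] hnu hs.
    have hwsD : wact ws (nu + x) \in D by apply: wact_root hw hs.1.
    have hcase := root_pos (wact_root hw hnu.1).
    have [h0|h0] := eqVneq (dotp nu th) 0.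
      have hwnu := hp _ hnu h0.
      have hwp : wact ws (nu + x) >+ by rewrite wactD; apply: posD => //; rewrite -wactD.
      split=> //; rewrite dotpDl h0 add0r; case: hor => [|hK]; [by left|right].
      by rewrite wactD; apply: K0D; rewrite -?wactD // (good_dotp _ hg).
    have hnu0 : 0 < dotp nu th by rewrite lt_neqAle eq_sym h0 pos_dom.
    have hd : 0 < dotp (nu + x) th by rewrite dotpDl; have := pos_dom hx; lra.
    split=> //; last by left.
    case: hcase => [hwnu|hwnu].
      by rewrite wactD; apply: posD => //; rewrite -wactD.
    (* If [x] is in H as well, the sum pairs with [th] above 1 and is therefore [th]. *)
    case: hor => [hx0|[hK1 hK2]].
      rewrite thP //; first by case: hs.
      by rewrite dotpDl; have := dotge _ hx hx0; have := dotge _ hnu hnu0; lra.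
    have [//|hn] := root_pos hwsD.
    (* For [b] in H with negative image, [a] minus this image is positive and pairs positively with
       [a]. For [nu + x] this is a root to which [K0] forbids adding [wact ws x], but the sum is the
       root [a - wact ws nu]. *)
    have hal b : b \in D -> 0 < dotp b th -> (- wact ws b) >+ ->
        (a - wact ws b) >+ /\ 0 < dotp (a - wact ws b) a.
      move=> hb hb0 hbn; have hne : wact ws b <> a.
        by move=> h; case: hbn => _; rewrite h; apply: pos_anti.
      have hb1 : 0 < dotp (wact ws b) a by rewrite (good_dotp _ hg).
      have [//|[h1 h2]] := long_pairing hl (wact_root hw hb) hb1.
      split; last by rewrite dotpDl dotpNl; lra.
      by apply: posD => //; rewrite -opprB root_opp.
    have [h1 h2] := hal _ hs.1 hd hn.
    have := hK2 _ h1 h2; rewrite wactD opprD -addrA subrK.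
    by have [[-> _] _] := hal _ hnu.1 hnu0 hwnu.
  + have HK x1 x2 : Imax_set a ws x1 -> 0 < dotp x1 th -> Imax_set a ws x2 ->
        ~ 0 < dotp x2 th -> ~ (x1 + x2) >+.
      move=> [h1 h2 _] h3 [h4 h5 [//|[_ hK]]] _ [hs _].
      have := hK _ h2; rewrite (good_dotp _ hg) => /(_ h3) /negP; apply.
      by rewrite -wactD; apply: wact_root.
    move=> x1 x2 H1 H2 Hs.
    have [d1|d1] := boolP (0 < dotp x1 th); have [d2|d2] := boolP (0 < dotp x2 th).
    (* The sum would be [th], and the simple root [a] a sum of two positive roots. *)
    - case: H1 H2 => [h1 h2 _] [h3 h4 _].
      have := thP _ Hs.1; rewrite wactD => E; apply: (base_indec ha h2 h4).
      by rewrite E // dotpDl; have := dotge _ h1 d1; have := dotge _ h3 d2; lra.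
    - by apply: HK H1 _ H2 _ Hs => //; apply/negP.
    - by rewrite addrC in Hs; apply: HK H2 _ H1 _ Hs => //; apply/negP.
    case: H1 H2 => [h1 h2 []]; first by rewrite (negPf d1).
    move=> K1 [h3 h4 []]; first by rewrite (negPf d2).
    (* Each image has the same coefficient at [a] as [th]; their sum would have twice that,
       exceeding the highest root. *)
    move=> K2; have := scoef_ge0 (Hth.2 _ (wact_root hw Hs.1)) ha.
    rewrite wactD scoefD scoefN scoefD !(K0_coef hl ha) //.
    by have := th_coef ha; lra.
- by exists th; split; [apply: th_pos | rewrite e | left].
Qed.

Lemma Imax_set_max a ws (J : 'rV[R]_n -> Prop) x : a \in Pi -> long D a ->
  good a ws -> Imin_ideal D Pi th a J -> J x -> Imax_set a ws x.
Proof.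
move=> ha hl hg [[[hJp hJu] hJa] _ hJ] hx; have [hw e hp] := hg.
have hxp := hJp _ hx.
have [h0|h0] := eqVneq (dotp x th) 0; last first.
  have hx0 : 0 < dotp x th by rewrite lt_neqAle eq_sym h0 pos_dom.
  have /(IminP _ ha hl hg) [_ _ h] : Imin D Pi th a x by apply/hJ.
  by split=> //; left.
split=> //; [exact: hp | right; split; first by rewrite (good_dotp _ hg)].
(* The preimage [y] of [b] lies in I(a)_min, hence in [J], and [y + x] would be a root, against [J]
   being abelian. *)
move=> b hb hba; apply/negP => hd; set y := wact (rev ws) b.
have ey : wact ws y = b by rewrite wactKrev // word_neq0.
have hy : y \in D by apply: wact_root (word_rev hw) hb.1.
have hy0 : 0 < dotp y th by rewrite -(good_dotp _ hg) ey.
have hyp := acute_pos hy hy0.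
have [hJy _] : J y /\ Hset D Pi th y by apply/hJ/(IminP _ ha hl hg); rewrite ey.
apply: (hJa _ _ hJy hx); apply: posD => //.
have -> : y + x = wact (rev ws) (b + wact ws x).
  by rewrite wactD wact_revK // word_neq0.
exact: wact_root (word_rev hw) hd.
Qed.

Lemma ImaxP a ws x : a \in Pi -> long D a -> good a ws ->
  Imax D Pi th a x <-> Imax_set a ws x.
Proof.
move=> ha hl hg; split.
  by move=> [J [[hJ _] hx]]; apply: Imax_set_max hJ hx.
move=> hx; exists (Imax_set a ws); split=> //; split; first exact: Imax_set_ideal.
by move=> J hJ y; apply: Imax_set_max hJ.
Qed.

End Roots.

Arguments scoef {R n} Pi a v.
Arguments height {R n} Pi v.
Arguments good {R n} D Pi th a ws.
Arguments K0 {R n} D Pi a g.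
Arguments Imax_set {R n} D Pi th a ws x.

(** * Walks in the Dynkin diagram and connected hulls *)

Section Dynkin.
Context {R : realFieldType} {n : nat} {D : seq 'rV[R]_n} (HD : root_system D).
Context {Pi : seq 'rV[R]_n} (HPi : is_base D Pi).
Context {th : 'rV[R]_n} (Hth : highest_root D Pi th).
Implicit Types (a b c g : 'rV[R]_n) (p : seq 'rV[R]_n).
Local Notation "g '>+'" := (posroot D Pi g) (at level 70).
Local Notation adj := (@dynkin_adj R n).
Local Notation long_simple a := (a \in Pi /\ long D a).

Lemma adjC a b : adj a b = adj b a.
Proof. by rewrite /dynkin_adj eq_sym dotpC. Qed.

Lemma adj_dotp a b : a \in Pi -> b \in Pi -> adj a b -> dotp a b < 0.
Proof.
by move=> ha hb /andP[h1 h2]; rewrite lt_neqAle h2 (base_obtuse HD HPi).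
Qed.

(** The starting point need not satisfy [X], which is why [reach_sym] asks for it. *)
Definition reach (X : 'rV[R]_n -> Prop) a b : Prop :=
  exists p, [/\ forall x, x \in p -> X x, path adj a p & last a p = b].

Lemma reach_refl X a : reach X a a.
Proof. by exists [::]. Qed.

Lemma reach_trans X a b c : reach X a b -> reach X b c -> reach X a c.
Proof.
move=> [p [h1 h2 h3]] [q [k1 k2 k3]]; exists (p ++ q); split.
- by move=> x; rewrite mem_cat => /orP[/h1|/k1].
- by rewrite cat_path h2 h3.
- by rewrite last_cat h3.
Qed.

Lemma reach_step (X : 'rV[R]_n -> Prop) a b : adj a b -> X b -> reach X a b.
Proof.
move=> h hb; exists [:: b]; split=> //= [x|]; last by rewrite h.
by rewrite inE => /eqP->.
Qed.

Lemma reach_sym (X : 'rV[R]_n -> Prop) a b : X a -> reach X a b -> reach X b a.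
Proof.
move=> ha [p [h1 h2 <-]]; elim: p a ha h1 h2 => [|b' p IH] a ha h1 /=.
  by move=> _; apply: reach_refl.
move=> /andP[h2 h3]; have hb : X b' by apply: h1; rewrite inE eqxx.
apply: (@reach_trans _ _ b'); last by apply: reach_step ha; rewrite adjC.
by apply: IH => // x hx; apply: h1; rewrite inE hx orbT.
Qed.

Lemma reach_path (X : 'rV[R]_n -> Prop) a p d : (forall x, x \in p -> X x) ->
  path adj a p -> d \in p -> reach X a d.
Proof.
move=> h1 + hd; case/splitPr: hd h1 => q r h1.
rewrite cat_path /= => /and3P[h2 h3 _]; exists (rcons q d); split.
- move=> x; rewrite mem_rcons => hx; apply: h1; move: hx.
  by rewrite !inE mem_cat inE => /orP[->|->]; rewrite ?orbT.
- by rewrite rcons_path h2.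
- by rewrite last_rcons.
Qed.

Lemma reach_uniq X a b : reach X a b ->
  exists p, [/\ forall x, x \in p -> X x, path adj a p, last a p = b & uniq (a :: p)].
Proof.
move=> [p [h1 h2 <-]]; case/shortenP: h2 => q k1 k2 k3; exists q; split=> //.
by move=> x /k3 /h1.
Qed.

(** If all members of [S] could be joined while avoiding [c], their component in [T] minus [c] would
    be a smaller connected set containing [S]. *)
Lemma hull_cut (S T : 'rV[R]_n -> Prop) c : conn_hull D Pi S T -> T c -> ~ S c ->
  exists a b, [/\ S a, S b & ~ reach (fun x => T x /\ x <> c) a b].
Proof.
move=> [hT hST hc hmin] hTc hSc; apply: NNPP => hn.
have [[a ha]|he] := classic (exists a, S a); last first.
  apply: (hmin (fun _ => False) _ _ _ c hTc) => // a ha.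
  by case: he; exists a.
pose X x := T x /\ x <> c.
have hXa : X a by split; [exact: hST | move=> e; apply: hSc; rewrite -e].
have hX x : reach X a x -> X x.
  by move=> [p [h1 _ <-]]; case: p h1 => //= b p h1; apply/h1/mem_last.
suff /hX[] : reach X a c by [].
apply: hmin hTc; last 1 first.
- move=> x y hx hy; have [p [h1 h2 h3]] := reach_trans (reach_sym hXa hx) hy.
  exists p; split=> // z hz; apply: reach_trans hx _; exact: reach_path hz.
- by move=> x /hX[/hT].
- by move=> x hx; apply: NNPP => h; apply: hn; exists a, x.
Qed.

(** [s] collects what was traversed before [c]. The next [d] is absent from [s] and adjacent to [c],
    so it is at an obtuse angle to [s + c] and can be added. *)
Lemma path_sum_pos p c s : c \in Pi -> (forall x, x \in p -> x \in Pi) ->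
  path adj c p -> uniq (c :: p) -> nncomb Pi s ->
  (forall d, d \in p -> scoef Pi d s = 0) -> (s + c) >+ ->
  (s + (c + \sum_(d <- p) d)) >+.
Proof.
elim: p c s => [|d p IH] c s hc hp; first by rewrite big_nil addr0.
move=> /= /andP[h1 h2] /andP[h3 h4] hs hds hsc.
have hd : d \in Pi by apply: hp; rewrite inE eqxx.
rewrite big_cons !addrA -(addrA (s + c)); apply: IH => //.
- by move=> x hx; apply: hp; rewrite inE hx orbT.
- by case: hsc.
- move=> e he; have heP : e \in Pi by apply: hp; rewrite inE he orbT.
  rewrite scoefD hds ?inE ?he ?orbT // (scoef_bb HPi heP hc) add0r.
  by case: eqP he => // <- he; move: h3; rewrite inE he orbT.
apply: (posD hsc (base_pos HPi hd)).
have hlt : dotp (s + c) d < 0.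
  rewrite dotpDl; have := adj_dotp hc hd h1.
  have := scoef0_obtuse HD HPi hs hd; rewrite hds ?inE ?eqxx // => /(_ erefl).
  by lra.
have [h|//] := root_add HD hsc.1 (base_root HPi hd) hlt.
by case: (posD_neq0 HD HPi hsc (base_pos HPi hd)).
Qed.

Lemma simple_path_pos p c : c \in Pi -> (forall x, x \in p -> x \in Pi) ->
  path adj c p -> uniq (c :: p) -> (c + \sum_(d <- p) d) >+.
Proof.
move=> hc hp h1 h2; rewrite -[X in X >+]add0r; apply: path_sum_pos => //.
- exact: nncomb0.
- by move=> d _; apply: scoef0.
- by rewrite add0r; exact: (base_pos HPi hc).
Qed.

(** * Connectedness of the diagram and the nodes attached to [th] *)

Lemma pairing_le a b : a \in D -> b \in D -> dotp b a < 0 ->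
  2 * dotp b a <= - dotp a a.
Proof.
move=> ha hb h; have [z hz] := root_int HD ha hb; have sa := root_sq_gt0 HD ha.
have z0 : z < 0 by rewrite -(ltrz0 R) -(pmulr_llt0 _ sa) -hz; lra.
have : z%:~R <= -1 :> R by rewrite -(mulrN1z 1) ler_int; lia.
by rewrite hz; nra.
Qed.

Lemma ler_sum_sub (L M : seq 'rV[R]_n) (f : 'rV[R]_n -> R) : uniq L -> uniq M ->
  {subset M <= L} -> (forall d, d \in L -> d \notin M -> f d <= 0) ->
  \sum_(d <- L) f d <= \sum_(d <- M) f d.
Proof.
move=> hL hM hs hf; rewrite (bigID (mem M)) /=.
have -> : \sum_(d <- L | d \in M) f d = \sum_(d <- M) f d.
  rewrite -big_filter; apply: perm_big; apply: uniq_perm => // [|d].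
    exact: filter_uniq.
  by rewrite mem_filter andb_idr // => /hs.
rewrite gerDl big_seq_cond; apply: sumr_le0 => d /andP[h1 h2].
exact: hf.
Qed.

(** Climb from [a] to [th], in which every simple root occurs; each simple root added on the way is
    joined to the current support. *)
Lemma dynkin_connected a b : a \in Pi -> b \in Pi -> reach (fun x => x \in Pi) a b.
Proof.
move=> ha hb.
suff h : forall d, d \in Pi -> scoef Pi d th != 0 -> reach (fun x => x \in Pi) a d.
  apply: (h b hb); rewrite gt_eqF // (lt_le_trans ltr01) //.
  exact: (th_coef HPi Hth).
pose Q g := forall d, d \in Pi -> scoef Pi d g != 0 -> reach (fun x => x \in Pi) a d.
suff H : forall g, g >+ -> Q g -> Q th.
  apply: (H a (base_pos HPi ha)) => d hd; rewrite (scoef_bb HPi hd ha).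
  by have [<- _|_] := eqVneq a d; [apply: reach_refl | rewrite mulr0n eqxx].
move=> g hg; have [m hm] := height_nat HPi (Hth.2 _ hg.1).
have {hm} : height Pi (th - g) < m.+1%:R by rewrite hm ltr_nat.
elim: m.+1 g hg => [|k IH] g hg hk hQ.
  by have [m' e] := height_nat HPi (Hth.2 _ hg.1); move: hk; rewrite e ltr_nat.
have [<-//|/eqP hne] := eqVneq g th.
have [s hs hd] := th_climb HD HPi Hth hg hne.
have hps := base_pos HPi hs.
apply: (IH (g + s)) => //; first exact: posD hg hps hd.
  by move: hk; rewrite !(heightD, heightN, height_base HPi hs) -natr1; lra.
have hRs : reach (fun x => x \in Pi) a s.
  have [h0|/hQ] := eqVneq (scoef Pi s g) 0; last exact.
  (* If the new [s] were orthogonal to [g], reflecting [g + s] would give the root [g - s]. Its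
     coefficient at [s] is -1, so [s - g] is positive and [s] would decompose. *)
  have [hgs|hgs] := eqVneq (dotp g s) 0.
    have hr := root_refl HD hps.1 hd.
    rewrite reflD refl_self ?(root_neq0 HD hps.1) // refl_orth // in hr.
    have [[_ h]|h] := root_pos HD HPi hr.
      have := scoef_ge0 HPi h hs; rewrite scoefD scoefN h0 (scoef_bb HPi hs hs) eqxx.
      by rewrite mulr1n; lra.
    by case: (base_indec HD HPi hs hg h); rewrite opprB addrC subrK.
  have [d [hdP hdc hda]] : exists d, [/\ d \in Pi, scoef Pi d g != 0 & dotp d s != 0].
    apply: NNPP => hn; case/eqP: hgs; have [c e _] := nncombP HPi hg.2.
    rewrite e dotpC dotp_sumr big_seq big1 // => d hdP; rewrite dotpZr.
    have [->|h1] := eqVneq (scoef Pi d g) 0; first by rewrite mul0r.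
    have [h2|h2] := eqVneq (dotp d s) 0; first by rewrite dotpC h2 mulr0.
    by case: hn; exists d.
  apply: reach_trans (hQ d hdP hdc) _; apply: reach_step hs.
  rewrite /dynkin_adj hda andbT; apply: contraNneq hdc => e.
  by rewrite e h0.
move=> d hdP; rewrite scoefD (scoef_bb HPi hdP hs).
have [<- //|_] := eqVneq s d; by rewrite addr0; apply: hQ.
Qed.

(** The simple roots on a path from [a] to [b] add up to a root whose pairing with [th] is at least
    2, so this root is [th] and the path exhausts [Pi]. The cycle closed by [- th] then forces the
    Cartan integers. *)
Lemma th_node_typeA a b : a \in Pi -> b \in Pi -> a != b ->
  dotp th a != 0 -> dotp th b != 0 -> typeA Pi.
Proof.
move=> ha hb hab hta htb.
have sth := root_sq_gt0 HD (th_root Hth).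
have thlong := th_long HD HPi Hth.
have htd c : c \in Pi -> 0 <= dotp c th by move=> hc; rewrite dotpC (th_dom HD HPi Hth).
have hpair c : c \in Pi -> dotp th c != 0 -> dotp th th <= 2 * dotp c th.
  move=> hc h0; have hlt : 0 < dotp c th by rewrite lt_neqAle htd // andbT eq_sym dotpC.
  by have [->|[-> _]] := long_pairing HD thlong (base_root HPi hc) hlt; lra.
have [p [hp hadj hlast hu]] := reach_uniq (dynkin_connected ha hb).
set L := a :: p in hu *.
have hL c : c \in L -> c \in Pi by rewrite inE => /orP[/eqP->|/hp].
have hbp : b \in p.
  by have := mem_last a p; rewrite hlast inE eq_sym (negPf hab).
have hsum : th = \sum_(d <- L) d.
  have hpos := simple_path_pos ha hp hadj hu.
  rewrite /L big_cons; symmetry; apply: (long_pairing_gt HD thlong hpos.1).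
  rewrite dotpDl (dotpC (\sum_(d <- p) d)) dotp_sumr; have hup : uniq p by case/andP: hu.
  rewrite (bigD1_seq b) //= mulrDr.
  set X := \sum_(_ <- _ | _) _.
  have hX : 0 <= X.
    rewrite /X big_seq_cond; apply: sumr_ge0 => d /andP[/hp hd _].
    by rewrite dotpC htd.
  by have := hpair a ha hta; have := hpair b hb htb; rewrite (dotpC th b); lra.
have hperm : perm_eq L Pi.
  apply: uniq_perm => //; first by case: HPi.
  move=> c; apply/idP/idP => [/hL //|hc]; apply: contraT => hn.
  have := th_coef HPi Hth hc; rewrite hsum.
  have -> : scoef Pi c (\sum_(d <- L) d) = 0; last by lra.
  rewrite big_seq; apply: (big_ind (fun v => scoef Pi c v = 0)).
  - exact: scoef0.
  - by move=> u v h1 h2; rewrite scoefD h1 h2 addr0.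
  - move=> d hd; rewrite (scoef_bb HPi hc (hL d hd)).
    by case: eqP hd hn => // -> ->.
exists L; split=> // i j hi hj.
pose Z := - th :: L; pose c := L`_j.
have hcL : c \in L by apply: mem_nth.
have hc := hL _ hcL; have sc := root_sq_gt0 HD (base_root HPi hc).
have hcD := base_root HPi hc; pose f d := 2 * dotp d c.
have hthL : - th \notin L.
  apply/negP => /hL /(base_pos HPi) [_ h].
  exact: (pos_anti HD HPi (th_pos HD HPi Hth)) h.
have hZu : uniq Z by rewrite /= hthL.
have hZ0 : \sum_(d <- Z) f d = 0.
  have -> : \sum_(d <- Z) f d = 2 * dotp c (\sum_(d <- Z) d).
    by rewrite dotp_sumr mulr_sumr; apply: eq_bigr => d _; rewrite /f dotpC.
  by rewrite big_cons -hsum addNr dotp0r mulr0.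
have hfle d : d \in Z -> d != c -> f d <= 0.
  rewrite inE => /orP[/eqP->|/hL hd] hne.
    by rewrite /f dotpNl dotpC; have := htd c hc; lra.
  by have := base_obtuse HD HPi hd hc hne; rewrite /f; lra.
have hfadj d : d \in Pi -> adj d c -> f d <= - dotp c c.
  by move=> hd h; apply: pairing_le; rewrite ?(base_root HPi) // adj_dotp.
have hfth : dotp th c != 0 -> f (- th) <= - dotp c c.
  move=> h; apply: (pairing_le hcD (root_opp HD (th_root Hth))).
  by rewrite dotpNl oppr_lt0 lt_neqAle eq_sym h (th_dom HD HPi Hth).
(* [Z] is the extended Dynkin diagram, a cycle; its elements sum to [0]. *)
pose prev := nth (- th) Z j; pose next := nth (- th) L j.+1.
(* Indices in [Z] are shifted by one, so [prev] is [- th] at the first root; the default [- th] does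
   the same for [next] at the last one. *)
have hcz : c = nth (- th) Z j.+1 by rewrite /= (set_nth_default 0).
have hsz : (1 < size L)%N by rewrite /= ltnS; move: hbp; clear; case: p.
have hprev : prev \in Z by rewrite /prev mem_nth // ltnW.
have hnext : next \in Z.
  rewrite /next; have [h|h] := ltnP j.+1 (size L).
    by rewrite inE mem_nth ?orbT.
  by rewrite nth_default // inE eqxx.
have hpc : prev != c by rewrite hcz /prev nth_uniq //= ?neq_ltn ?ltnSn // ltnW.
have hnc : next != c.
  rewrite /next; have [h|h] := ltnP j.+1 (size L).
    by rewrite /c (set_nth_default 0) // nth_uniq ?neq_ltn ?ltnSn ?orbT.
  by rewrite nth_default //; apply: contraNneq hthL => ->.
have hpn : prev != next.
  rewrite /prev /next; have [h|h] := ltnP j.+1 (size L).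
    rewrite -[nth _ L _]/(nth (- th) Z j.+2) nth_uniq //= ?neq_ltn ?ltnS ?leqnSn //.
    by rewrite ltnW // ltnW.
  rewrite (nth_default _ h); case: (j) hj h => [|k] hk h.
    by rewrite leqNgt hsz in h.
  by rewrite /=; apply: contraNneq hthL => <-; rewrite mem_nth // ltnW.
have hpf : f prev <= - dotp c c.
  have [k0|[k hk]] : j = 0%N \/ exists k, j = k.+1 by case: (j); [left|right; eexists].
    by rewrite /prev k0 /=; apply: hfth; rewrite /c k0.
  have hk' : (k < size p)%N by rewrite -ltnS -hk.
  rewrite /prev hk /= (set_nth_default 0); last by rewrite /= ltnS ltnW.
  apply: hfadj; first by apply: hL; rewrite mem_nth //= ltnS ltnW.
  by rewrite /c hk; move/(pathP 0): hadj; apply.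
have hnf : f next <= - dotp c c.
  rewrite /next; have [h|h] := ltnP j.+1 (size L).
    rewrite (set_nth_default 0) //; apply: hfadj; first by apply: hL; rewrite mem_nth.
    by rewrite adjC; move/(pathP 0): hadj; apply.
  rewrite nth_default //; apply: hfth.
  suff -> : c = b by [].
  have e : j = size p by apply/eqP; rewrite eqn_leq -ltnS hj.
  by rewrite /c -hlast (last_nth 0) e.
have hfc : f c = 2 * dotp c c by [].
have hcZ : c \in Z by rewrite inE hcL orbT.
(* Over all of [Z] the sum is 0, and only [c] contributes positively, namely [2 * dotp c c]. Both
   neighbours take away at least [dotp c c], so they take exactly that and all other terms
   vanish. *)
have hle M : uniq M -> {subset M <= Z} -> c \in M -> 0 <= \sum_(d <- M) f d.
  move=> hMu hMs hMc; have := @ler_sum_sub Z M f hZu hMu hMs; rewrite hZ0; apply.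
  move=> d hd hdM.
  by apply: hfle => //; apply: contraNneq hdM => ->.
have h3 : 0 <= f c + (f prev + f next).
  have := hle [:: c; prev; next]; rewrite !big_cons big_nil addr0; apply.
  - by rewrite /= !inE negb_or eq_sym hpc eq_sym hnc hpn.
  - by move=> d; rewrite !inE => /or3P[] /eqP->; rewrite -?in_cons.
  - by rewrite inE eqxx.
have hcart d : cartan d c = f d / dotp c c by [].
rewrite -/c hcart; have [e|hij] := eqVneq i j.
  by rewrite e -/c hfc mulfK // gt_eqF.
have hid : L`_i \in Z by rewrite inE mem_nth ?orbT.
have hic : L`_i != c by rewrite /c nth_uniq.
have [/orP[/eqP e|/eqP e]|] := boolP ((i == j.+1) || (j == i.+1)).
- have -> : L`_i = next by rewrite /next -e; apply: set_nth_default.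
  have -> : f next = - dotp c c by apply/eqP; rewrite eq_le hnf /=; lra.
  by rewrite mulNr divff // gt_eqF.
- have -> : L`_i = prev by rewrite /prev e; apply: set_nth_default.
  have -> : f prev = - dotp c c by apply/eqP; rewrite eq_le hpf /=; lra.
  by rewrite mulNr divff // gt_eqF.
rewrite negb_or => /andP[h4 h5].
have hip : L`_i != prev.
  rewrite (set_nth_default (- th)) // -[nth _ L _]/(nth (- th) Z i.+1) nth_uniq //=.
    by rewrite eq_sym.
  exact: ltnW.
have hin : L`_i != next.
  rewrite /next; have [h|h] := ltnP j.+1 (size L).
    by rewrite (set_nth_default (- th)) // nth_uniq.
  by rewrite (nth_default _ h); apply: contraNneq hthL => <-; rewrite mem_nth.
have h6 : 0 <= f L`_i + (f c + (f prev + f next)).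
  have := hle [:: L`_i; c; prev; next]; rewrite !big_cons big_nil addr0; apply.
  - rewrite /= !inE !negb_or hic hip hin hpn.
    by rewrite [c == prev]eq_sym hpc [c == next]eq_sym hnc.
  - by move=> d; rewrite !inE => /or4P[] /eqP->; rewrite -?in_cons.
  - by rewrite !inE eqxx orbT.
have -> : f L`_i = 0; last by rewrite mul0r.
by apply/eqP; rewrite eq_le hfle //=; lra.
Qed.

End Dynkin.

(** * Following I(.)_min and I(.)_max along paths of long simple roots *)

Section Convexity.
Context {R : realFieldType} {n : nat} {D : seq 'rV[R]_n} (HD : root_system D).
Context {Pi : seq 'rV[R]_n} (HPi : is_base D Pi).
Context {th : 'rV[R]_n} (Hth : highest_root D Pi th).
Implicit Types (a b c g : 'rV[R]_n) (p : seq 'rV[R]_n).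
Local Notation "g '>+'" := (posroot D Pi g) (at level 70).
Local Notation adj := (@dynkin_adj R n).
Local Notation long_simple a := (a \in Pi /\ long D a).

Lemma adj_long a b : long_simple a -> long_simple b -> adj a b ->
  [/\ 2 * dotp a b = - dotp a a, dotp b b = dotp a a,
      refl a b = b + a & refl b a = a + b].
Proof.
move=> [ha la] [hb lb] hadj; have hlt := adj_dotp HD HPi ha hb hadj.
have e : dotp b b = dotp a a by apply/eqP; rewrite eq_le la.2 ?lb.2 // ?la.1 ?lb.1.
have hne : b <> - a.
  move=> h; have := base_pos HPi ha; have := base_pos HPi hb; rewrite h => -[_ h1] h2.
  exact: (pos_anti HD HPi h2).
have hne' : a <> - b by move=> h; apply: hne; rewrite h opprK.
have hlt' : dotp b a < 0 by rewrite dotpC.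
have [//|[h1 h2 _]] := long_pairingN HD la lb.1 hlt'.
have [//|[_ h3 _]] := long_pairingN HD lb la.1 hlt.
by split=> //; rewrite dotpC.
Qed.

(** A simple reflection makes only its own root negative, and [refl b y = a] means [y = a + b]. *)
Lemma adj_step a b y : long_simple a -> long_simple b -> adj a b ->
  y >+ -> y <> b ->
  refl a (refl b y) >+ \/ y = a + b /\ refl a (refl b y) = - a.
Proof.
move=> ha hb hadj hy hyb; have [_ _ _ h4] := adj_long ha hb hadj.
have a0 := root_neq0 HD ha.2.1; have b0 := root_neq0 HD hb.2.1.
have hp := base_refl_pos HD HPi hb.1 hy hyb.
have [e|/eqP hne] := eqVneq (refl b y) a; last first.
  by left; apply: (base_refl_pos HD HPi ha.1 hp hne).
by right; rewrite e refl_self // -h4 -e reflK.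
Qed.

(** [refl b] takes [a] to [a + b], which [refl a] takes to [b]. The only positive roots that could
    turn negative, [b] and [a + b], are not orthogonal to [a]. *)
Lemma good_step a b ws : long_simple a -> long_simple b -> adj a b ->
  good D Pi th a ws -> good D Pi th b (a :: b :: ws).
Proof.
move=> ha hb hadj hg; have [hw e hp] := hg.
have [h1 _ h3 h4] := adj_long ha hb hadj.
have sa := root_sq_gt0 HD ha.2.1.
split.
- exact: word_cons ha.1 (word_cons hb.1 hw).
- rewrite !wact_cons e h4 reflD refl_self ?(root_neq0 HD ha.2.1) // h3.
  by rewrite addrC addrK.
move=> g hpg h0; have hy := hp _ hpg h0.
have hya : dotp (wact ws g) a = 0 by rewrite (good_dotp HD HPi _ hg).
rewrite !wact_cons; have [|//|[ey _]] := adj_step ha hb hadj hy.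
  by move=> ey; move: hya; rewrite ey dotpC; lra.
by move: hya; rewrite ey dotpDl (dotpC b a); lra.
Qed.

(* Once [x] has left [I(c)_min] along a path of long simple roots, the root
   [- w_c x] only involves simple roots already visited, and the next simple
   root of the path is orthogonal to it. *)
Lemma lost_along p c ws x z : good D Pi th c ws -> long_simple c ->
  (forall d, d \in p -> long_simple d) -> path adj c p -> uniq (c :: p) ->
  0 < dotp x th -> wact ws x = - z -> z >+ ->
  (forall d, d \in c :: p -> scoef Pi d z = 0) ->
  exists2 ws', good D Pi th (last c p) ws' & (- wact ws' x) >+.
Proof.
elim: p c ws z => [|b p IH] c ws z hg hc hp /=.
  by move=> _ _ _ e hz _; exists ws => //; rewrite e opprK.
move=> /andP[hadj hpath] /andP[hcn hu] hx e hz hz0.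
have hb : long_simple b by apply: hp; rewrite inE eqxx.
have sc := root_sq_gt0 HD hc.2.1.
have hzc : dotp z c < 0.
  by have := good_dotp HD HPi x hg; rewrite e dotpNl; lra.
have hc0 := base_pos HPi hc.1.
have [ez|[hzc2 hrz hzD]] := long_pairingN HD hc.2 hz.1 hzc.
  by case: (posD_neq0 HD HPi hz hc0); rewrite ez addNr.
have hzp := posD hz hc0 hzD.
have [h1 h2 h3 h4] := adj_long hc hb hadj.
(* If [dotp z b < 0], the negative root [- (z + c)] would pair with [b] above 1 and so equal [b]. *)
have hzb : dotp z b = 0.
  have hle : dotp z b <= 0.
    by apply: (scoef0_obtuse HD HPi hz.2 hb.1); apply: hz0; rewrite !inE eqxx orbT.
  apply/eqP; rewrite eq_le hle leNgt; apply/negP => hlt.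
  have := long_pairing_gt HD hb.2 (root_opp HD hzD).
  rewrite dotpNl dotpDl => /(_ _) h; have eb : - (z + c) = b by apply: h; lra.
  by case: (posD_neq0 HD HPi hzp (base_pos HPi hb.1)); rewrite -eb subrr.
apply: (IH b (c :: b :: ws) (z + c)) => //.
- exact: good_step.
- by move=> d hd; apply: hp; rewrite inE hd orbT.
- rewrite !wact_cons e -[- z]scaleN1r !reflZ (refl_orth hzb) hrz.
  by rewrite scaleN1r.
- move=> d hd; have hdP : d \in Pi.
    by move: hd; rewrite inE => /orP[/eqP->|hd]; [case: hb|
      have [] := hp d _; rewrite // inE hd orbT].
  rewrite scoefD (scoef_bb HPi hdP hc.1) hz0 ?add0r; last by rewrite inE hd orbT.
  by case: eqP => // ecd; rewrite ecd hd in hcn.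
Qed.

(** If [x] is lost on passing from [c] to [b], its image becomes [- c], and [lost_along] keeps the
    image negative up to the end of the path. *)
Lemma path_Imin p c x : long_simple c -> (forall d, d \in p -> long_simple d) ->
  path adj c p -> uniq (c :: p) -> Imin D Pi th c x ->
  Imin D Pi th (last c p) x -> forall d, d \in p -> Imin D Pi th d x.
Proof.
elim: p c => [//|b p IH] c hc hp /= /andP[hadj hpath] /andP[hcn hu] hIc hIl.
have hb : long_simple b by apply: hp; rewrite inE eqxx.
have hp' d : d \in p -> long_simple d by move=> hd; apply: hp; rewrite inE hd orbT.
have [hIb|hIb] := classic (Imin D Pi th b x).
  by move=> d; rewrite inE => /orP[/eqP->//|]; apply: (IH b).
exfalso; have [ws hg] := good_ex HD HPi Hth hc.1 hc.2.
have [hx hxth hy] := (IminP HD HPi Hth x hc.1 hc.2 hg).1 hIc.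
have hgb := good_step hc hb hadj hg.
have [h1 h2 h3 h4] := adj_long hc hb hadj; have sc := root_sq_gt0 HD hc.2.1.
have hyb : wact ws x <> b.
  by move=> e; have := good_dotp HD HPi x hg; rewrite e dotpC; lra.
have [h|[_ e]] := adj_step hc hb hadj hy hyb.
  by apply: hIb; apply/(IminP HD HPi Hth x hb.1 hb.2 hgb).
have [] := @lost_along p b _ x c hgb hb hp' hpath hu hxth e (base_pos HPi hc.1).
  move=> d hd; have hdP : d \in Pi.
    by move: hd; rewrite inE => /orP[/eqP->|/hp' []//]; case: hb.
  by rewrite (scoef_bb HPi hdP hc.1); case: eqP => // ecd; rewrite ecd hd in hcn.
move=> ws' hg' hn.
have hl : long_simple (last b p) by apply: hp; apply: mem_last.
have [_ _ [_ h]] := (IminP HD HPi Hth x hl.1 hl.2 hg').1 hIl.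
by apply: (pos_anti HD HPi hn); rewrite opprK.
Qed.

(** By [hull_cut], a [c] outside [S] lies on every path in [T] between two suitable members of
    [S]. *)
Lemma Imin_hull (S T : 'rV[R]_n -> Prop) x c : conn_hull D Pi S T -> T c ->
  (forall a, S a -> Imin D Pi th a x) -> Imin D Pi th c x.
Proof.
move=> hT hTc hx; have [hTl hST hconn _] := hT.
have [/hx //|hSc] := classic (S c).
have [a [b [ha hb hn]]] := hull_cut hT hTc hSc.
have [p [h1 h2 h3 h4]] : exists p, [/\ forall x, x \in p -> T x, path adj a p,
    last a p = b & uniq (a :: p)].
  apply: reach_uniq; have [q [q1 [q2 q3]]] := hconn a b (hST a ha) (hST b hb).
  by exists q.
have hcp : c \in p.
  apply: contraT => hcn; case: hn; exists p; split=> // y hy; split; first exact: h1.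
  by move=> e; rewrite -e hy in hcn.
apply: (@path_Imin p a) => //; [exact/hTl/hST | by move=> d /h1 /hTl | exact: hx|].
by rewrite h3; apply: hx.
Qed.

(** Let [e + g] be a root with [dotp e b > 0]. [K0] at [a] excludes [dotp e a > 0] directly and
    [dotp e a < 0] through [e + a]. So [e] is orthogonal to [a], and then [e - b] violates [K0] at
    [a]. *)
Lemma K0_adj a b g : long_simple a -> long_simple b -> adj a b -> g >+ ->
  dotp g b = 0 -> K0 D Pi a g -> K0 D Pi b g.
Proof.
move=> ha hb hadj hg hgb [hga hK]; split=> // e he heb; apply/negP => hd.
have [h1 h2 _ _] := adj_long ha hb hadj.
have sa := root_sq_gt0 HD ha.2.1.
have hpa := base_pos HPi ha.1.
have he0 : dotp e a = 0.
  apply/eqP; rewrite eq_le !leNgt; apply/andP; split; apply/negP => hlt.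
    by have := hK e he hlt; rewrite hd.
  have [ee|[e1 _ e2]] := long_pairingN HD ha.2 he.1 hlt.
    by case: (posD_neq0 HD HPi he hpa); rewrite ee addNr.
  have := hK _ (posD he hpa e2); rewrite dotpDl => /(_ _) /negP; case; first by lra.
  have hlt2 : dotp (e + g) a < 0 by rewrite dotpDl hga addr0.
  have [ee|[_ _]] := long_pairingN HD ha.2 hd hlt2; last by rewrite addrAC.
  by case: (posD_neq0 HD HPi (posD he hg hd) hpa); rewrite ee addNr.
have [ee|[e1 e2]] := long_pairing HD hb.2 he.1 heb.
  by move: he0; rewrite ee dotpC; lra.
have hp := base_sub_pos HD HPi hb.1 he e2.
have := hK _ hp; rewrite dotpDl dotpNl (dotpC b) => /(_ _) /negP; case; first by lra.
have hlt : 0 < dotp (e + g) b by rewrite dotpDl hgb addr0.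
have [ee|[_]] := long_pairing HD hb.2 hd hlt; last by rewrite addrAC.
by case: (base_indec HD HPi hb.1 he hg).
Qed.

(** The image of [x] is orthogonal to every root of the path, so the reflections of [good_step] fix
    it. *)
Lemma K0_path p c ws x : long_simple c -> (forall d, d \in p -> long_simple d) ->
  path adj c p -> good D Pi th c ws -> (wact ws x) >+ -> K0 D Pi c (wact ws x) ->
  (forall d, d \in p -> dotp (wact ws x) d = 0) ->
  exists2 ws', good D Pi th (last c p) ws' &
    (wact ws' x) >+ /\ K0 D Pi (last c p) (wact ws' x).
Proof.
elim: p c ws => [|b p IH] c ws hc hp /=; first by move=> _ hg h1 h2 _; exists ws.
move=> /andP[hadj hpath] hg hy hK h0.
have hb : long_simple b by apply: hp; rewrite inE eqxx.
have hyb : dotp (wact ws x) b = 0 by apply: h0; rewrite inE eqxx.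
have e : wact (c :: b :: ws) x = wact ws x.
  by rewrite !wact_cons (refl_orth hyb) refl_orth //; case: hK.
apply: (IH b (c :: b :: ws)) => //; rewrite ?e //.
- by move=> d hd; apply: hp; rewrite inE hd orbT.
- exact: good_step.
- exact: K0_adj hyb hK.
- by move=> d hd; apply: h0; rewrite inE hd orbT.
Qed.

(* Going down from [th] to [g], the first simple root subtracted is [t], and each
   later one is adjacent to an earlier one, so none leaves the component of [t]
   in the Dynkin diagram minus [c]. *)
Lemma K0_branch c t g : long_simple c -> t \in Pi ->
  (forall s, s \in Pi -> s <> t -> dotp th s = 0) -> g >+ -> K0 D Pi c g ->
  forall b, b \in Pi -> b <> c -> ~ reach (fun x => x \in Pi /\ x <> c) t b ->
    dotp g b = 0.
Proof.
move=> hc ht huniq hg hK b hb hbc hn.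
set B := reach _ t in hn *.
pose P g := forall b, b \in Pi -> b <> c -> ~ B b ->
  dotp g b = 0 /\ scoef Pi b g = scoef Pi b th.
suff : P g by move=> /(_ b hb hbc hn)[].
move: g hg hK {b hb hbc hn}; apply: (K0_ind HD HPi Hth hc.2 hc.1).
  move=> b hb hbc hn; split=> //; apply: huniq => // e.
  by apply: hn; rewrite e; apply: reach_refl.
move=> g s hg hs hgs hsc IH.
have sc := root_sq_gt0 HD hc.2.1.
have hsne : s <> c by move=> e; move: hsc; rewrite e; lra.
(* Otherwise [g + s] is orthogonal to [s] with the same coefficient at [s] as [th], and reflecting
   [g] in [s] gives the root [g + 2s], which exceeds [th]. *)
have hBs : B s.
  apply: NNPP => hn; have [h1 h2] := IH s hs hsne hn.
  have hr := root_refl HD (base_root HPi hs) hg.1.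
  have e : g = g + s - s by rewrite addrK.
  have s0 := root_neq0 HD (base_root HPi hs).
  rewrite e -[- s]scaleN1r reflD reflZ refl_self // in hr.
  rewrite (refl_orth h1) scaleN1r opprK in hr.
  have := scoef_ge0 HPi (Hth.2 _ hr) hs.
  by rewrite scoefD scoefN scoefD h2 (scoef_bb HPi hs hs) eqxx mulr1n; lra.
move=> b hb hbc hn; have [h1 h2] := IH b hb hbc hn.
have hsb : s <> b by move=> e; apply: hn; rewrite -e.
have hsb0 : dotp s b = 0.
  apply/eqP; apply: contraT => h; case: hn; apply: (reach_trans hBs).
  by apply: reach_step => //; rewrite /dynkin_adj h andbT; apply/eqP.
split; first by move: h1; rewrite dotpDl hsb0 addr0.
move: h2; rewrite scoefD (scoef_bb HPi hb hs); case: eqP => // _.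
by rewrite addr0.
Qed.

(* Otherwise the Dynkin diagram would contain a cycle through [c]. *)
Lemma no_reach_around c u v : long_simple c -> u \in Pi -> v \in Pi ->
  u <> v -> adj c u -> adj c v -> ~ reach (fun x => x \in Pi /\ x <> c) u v.
Proof.
move=> hc hu hv huv hcu hcv /reach_uniq[p [h1 h2 h3 h4]].
have hpos := simple_path_pos HD HPi hu (fun x hx => (h1 x hx).1) h2 h4.
have sc := root_sq_gt0 HD hc.2.1.
have hlt w : w \in Pi -> adj c w -> 2 * dotp w c <= - dotp c c.
  move=> hw h; apply: (pairing_le HD hc.2.1 (base_root HPi hw)).
  by rewrite dotpC; apply: (adj_dotp HD HPi hc.1 hw h).
have hvp : v \in p.
  have := mem_last u p; rewrite h3 inE => /orP[/eqP e|//].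
  by case: huv.
have hup : uniq p by case/andP: h4.
have hle : 2 * dotp (u + \sum_(d <- p) d) c <= - dotp c c - dotp c c.
  rewrite dotpDl (dotpC (\sum_(d <- p) d)) dotp_sumr (bigD1_seq v) //=.
  set X := \sum_(_ <- _ | _) _.
  have hX : X <= 0.
    rewrite /X big_seq_cond; apply: sumr_le0 => d /andP[/h1[hd hdc] _].
    by apply: (base_obtuse HD HPi hc.1 hd); apply/eqP => e; apply: hdc.
  by have := hlt u hu hcu; have := hlt v hv hcv; rewrite (dotpC v); lra.
(* The negative of the path sum pairs with [c] to at least 2, so it would be [c]. *)
have := long_pairing_gt HD hc.2 (root_opp HD hpos.1).
rewrite dotpNl => /(_ _) h; have e : - (u + \sum_(d <- p) d) = c by apply: h; lra.
by case: (posD_neq0 HD HPi hpos (base_pos HPi hc.1)); rewrite -e subrr.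
Qed.

Lemma Imax_hull (S T : 'rV[R]_n -> Prop) x c : conn_hull D Pi S T ->
  ~ typeA Pi -> T c -> Imax D Pi th c x -> exists2 a, S a & Imax D Pi th a x.
Proof.
move=> hT htA hTc hIc; have [hTl hST hconn _] := hT.
have [hSc|hSc] := classic (S c); first by exists c.
have [a [b [ha hb hn]]] := hull_cut hT hTc hSc.
have hc := hTl c hTc; have [ws hg] := good_ex HD HPi Hth hc.1 hc.2.
have [hx hwx hor] := (ImaxP HD HPi Hth x hc.1 hc.2 hg).1 hIc.
have hl d : S d -> long_simple d by move=> /hST /hTl.
have [h0|h0] := eqVneq (dotp x th) 0; last first.
  have hx0 : 0 < dotp x th by rewrite lt_neqAle eq_sym h0 (pos_dom HD HPi Hth hx).
  (* If [x] is in no I(d)_max with [d] in [S], then [th - x] is in every I(d)_min, hence in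
     I(c)_min; the images of [x] and [th - x] would be positive with sum the simple root [c]. *)
  apply: NNPP => hne.
  have hno d : S d -> x <> th /\ Imin D Pi th d (th - x).
    move=> hd; have [hdPi hdl] := hl d hd.
    have [ws' hg'] := good_ex HD HPi Hth hdPi hdl; have [hw' e' _] := hg'.
    have [hp|hp] := root_pos HD HPi (wact_root HD HPi hw' hx.1).
      case: hne; exists d => //; apply/(ImaxP HD HPi Hth x hdPi hdl hg').
      by split=> //; left.
    have hxth : x <> th.
      move=> e; rewrite e e' in hp; case: hp => _.
      exact: (pos_anti HD HPi (base_pos HPi hdPi)).
    split=> //; apply/(IminP HD HPi Hth _ hdPi hdl hg').
    have [k1 k2] := th_sub HD HPi Hth hx.1 hx0 hxth; split=> //.
    split; first exact: (wact_root HD HPi hw' k1.1).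
    by rewrite wactD wactN e'; apply: nncombD; [case: (base_pos HPi hdPi)|case: hp].
  have := Imin_hull hT hTc (fun d hd => (hno d hd).2).
  move=> /(IminP HD HPi Hth _ hc.1 hc.2 hg)[_ _].
  have [_ e _] := hg; rewrite wactD wactN e => k.
  by case: (base_indec HD HPi hc.1 hwx k); rewrite addrC subrK.
have hK : K0 D Pi c (wact ws x) by case: hor => //; rewrite h0 ltxx.
have [t ht htth] : exists2 t, t \in Pi & 0 < dotp th t.
  exact: (pos_acute HD (th_pos HD HPi Hth)).
have huniq s : s \in Pi -> s <> t -> dotp th s = 0.
  move=> hs hst; apply/eqP; apply: contraT => hs0; case: htA.
  by apply: (th_node_typeA HD HPi Hth hs ht) => //; [exact/eqP | rewrite gt_eqF].
pose X y := y \in Pi /\ y <> c.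
have hpath d : S d -> exists u q, [/\ forall y, y \in u :: q -> T y /\ y <> c,
    adj c u, path adj u q & last u q = d].
  move=> hd; have [p [p1 [p2 p3]]] := hconn c d hTc (hST d hd).
  have [|[|u q] [h1 h2 h3 h4]] := @reach_uniq _ _ T c d; first by exists p.
    by case: hSc; rewrite /= in h3; rewrite h3.
  move: h2 h4 => /= /andP[k1 k2] /andP[k3 _]; exists u, q; split=> // y hy.
  by split; [exact: h1 | move=> e; rewrite -e hy in k3].
have hXT y : T y /\ y <> c -> X y by move=> [/hTl[]].
(* When the path leaves [c] away from the component of [t], [K0_branch] makes the image of [x]
   orthogonal to all its roots, and [K0_path] applies. *)
have hfar d u q : S d -> (forall y, y \in u :: q -> T y /\ y <> c) -> adj c u ->
    path adj u q -> last u q = d -> ~ reach X t u -> exists2 a, S a & Imax D Pi th a x.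
  move=> hd h1 h2 h3 h4 hnu; exists d => //.
  have hXu : X u by apply/hXT/h1; rewrite inE eqxx.
  have [|||ws' hg' [k1 k2]] := @K0_path (u :: q) c ws x hc _ _ hg hwx hK.
  - by move=> y /h1 [/hTl].
  - by rewrite /= h2.
  - move=> y hy; have [hy1 hy2] := hXT y (h1 y hy).
    apply: (K0_branch hc ht huniq hwx hK hy1 hy2) => hr; apply: hnu.
    apply: (reach_trans hr); apply: (reach_sym hXu).
    move: hy; rewrite inE => /orP[/eqP->|hy]; first exact: reach_refl.
    by apply: (reach_path _ h3 hy) => z hz; apply/hXT/h1; rewrite inE hz orbT.
  rewrite /= h4 in hg' k2; have [hd1 hd2] := hl d hd.
  by apply/(ImaxP HD HPi Hth x hd1 hd2 hg'); split=> //; right.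
have [u [q [q1 q2 q3 q4]]] := hpath a ha.
have [v [r [r1 r2 r3 r4]]] := hpath b hb.
(* The paths to [a] and [b] cannot both start towards [t]: equal first nodes would join [a] and [b]
   without [c], distinct ones would close a cycle through [c]. *)
have [hu|hu] := classic (reach X t u); last exact: (hfar a u q).
have [hv|hv] := classic (reach X t v); last exact: (hfar b v r).
have hTu : T u /\ u <> c by apply: q1; rewrite inE eqxx.
have hTv : T v /\ v <> c by apply: r1; rewrite inE eqxx.
have [e|huv] := classic (u = v).
  case: hn.
  apply: (@reach_trans _ _ _ _ u).
    apply: (reach_sym hTu); exists q; split=> // y hy; apply: q1.
    by rewrite inE hy orbT.
  rewrite e; exists r; split=> // y hy; apply: r1.
  by rewrite inE hy orbT.
have ht_ : X t.
  split=> // e; move: htth; rewrite e.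
  by rewrite (K0_th HD HPi Hth hc.2 hc.1 hwx hK) ltxx.
case: (@no_reach_around c u v) => //; [exact: (hXT u hTu).1|exact: (hXT v hTv).1|].
exact: (reach_trans (reach_sym ht_ hu) hv).
Qed.

End Convexity.

Theorem theorem4p5 (R : realFieldType) (n : nat) (D Pi : seq 'rV[R]_n)
  (th : 'rV[R]_n) (S T : 'rV[R]_n -> Prop)
  (HD : root_system D) (Hirr : irreducible D) (HPi : is_base D Pi)
  (Hth : highest_root D Pi th)
  (HS : forall a, S a -> a \in Pi /\ long D a)
  (HT : conn_hull D Pi S T) :
  (forall x, (forall a, S a -> Imin D Pi th a x) <->
             (forall a, T a -> Imin D Pi th a x)) /\
  (~ typeA Pi ->
   forall x, (exists2 a, S a & Imax D Pi th a x) <->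
             (exists2 a, T a & Imax D Pi th a x)).
Proof.
have [_ hST _ _] := HT.
split=> [x|htA x]; split.
- by move=> h a ha; apply: (Imin_hull HD HPi Hth HT ha h).
- by move=> h a /hST; apply: h.
- by move=> [a /hST ha h]; exists a.
- by move=> [a ha h]; apply: (Imax_hull HD HPi Hth HT htA ha h).
Qed.
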